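(* Let $\gamma_n=c_\gamma n^{-\alpha}$ with $c_\gamma>0$ and $\alpha\in(1/2,1)$. Suppose the following hypotheses hold. (i) For every $h\in H$, $g(x,\cdot)$ is Fréchet-differentiable at $h$ for $P_X$-almost every $x\in\mathcal X$; $G$ is differentiable; and $m\in H$ satisfies $\nabla G(m)=0$. (ii) $G$ is twice continuously differentiable, and for every $A>0$ there is $C_A>0$ such that $\|\Gamma_h\|_{op}\le C_A$ for all $h\in\mathcal B(m,A)$. (iii) At least one of the following holds: (iii.a) there is $\epsilon>0$ such that for every $h\in\mathcal B(m,\epsilon)$ there is an orthonormal basis of $H$ composed of eigenvectors of $\Gamma_h$; the infimum $\lambda_{\min}$ of the eigenvalues of $\Gamma_m$ is positive; and for every $h\in\mathcal B(m,\epsilon)$, every eigenvalue $\lambda_h$ of $\Gamma_h$ satisfies $\lambda_h\ge\lambda_{\min}/2>0$; (iii.b) there is an orthonormal basis of $H$ composed of eigenvectors of $\Gamma_m$, the infimum $\lambda_{\min}$ of the eigenvalues of $\Gamma_m$ is positive, and there are constants $c,c'>0$ such that for all $A>0$ and all $h\in\mathcal B(m,A)$, $\langle\nabla G(h),h-m\rangle\ge\min\{c,c'/A\}\,\|h-m\|^2$. (iv) There are $\epsilon',C_{\epsilon'}>0$ such that $\|\nabla G(h)-\Gamma_m(h-m)\|\le C_{\epsilon'}\|h-m\|^2$ for all $h\in\mathcal B(m,\epsilon')$. (v) At least one of the following holds: (v.a) there are a measurable function $f:\mathcal X\times H\to\mathbb R_+$ and a constant $C>0$ such that for $P_X$-almost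 every $x\in\mathcal X$ and all $h\in H$, $\|\nabla_h g(x,h)\|\le f(x,h)+C\|h-m\|$, and for every integer $q\ge1$ there is $L_q>0$ such that $\mathbb E[f(X,h)^{2q}]\le L_q$ for all $h\in H$; (v.b) for every integer $q\ge1$ there is $L_q>0$ such that $\mathbb E[\|\nabla_h g(X,h)\|^{2q}]\le L_q(1+\|h-m\|^{2q})$ for all $h\in H$. Then, for every integer $p\ge1$, there is a positive constant $K_p'$ such that for all $n\ge1$, $$\mathbb E\left[\|\overline Z_n-m\|^{2p}\right]\le\frac{K_p'}{n^{p}}.$$
   Context: $H$ is a separable real Hilbert space with inner product $\langle\cdot,\cdot\rangle$ and norm $\|\cdot\|$; $\|\cdot\|_{op}$ is the operator (spectral) norm; $\mathcal B(m,r)=\{h\in H:\|h-m\|\le r\}$. $X$ is a random variable with law $P_X$ taking values in a measurable space $\mathcal X$, $g:\mathcal X\times H\to\mathbb R$, and $G(h):=\mathbb E[g(X,h)]$ is a well-defined real-valued function on $H$ which is assumed to be convex. $\nabla_h g(x,h)\in H$ denotes the gradient of $g(x,\cdot)$ at $h$ (viewed as a measurable function of $(x,h)$), and $\nabla G(h)=\mathbb E[\nabla_h g(X,h)]$ for all $h\in H$. $\Gamma_h$ denotes the Hessian of $G$ at $h$ (a bounded self-adjoint operator on $H$). Algorithms: $X_1,X_2,\dots$ are independent random variables with the same law as $X$; $\mathcal F_n=\sigma(X_1,\dots,X_n)$; $Z_1$ is an $\mathcal F_1$-measurable bounded $H$-valued random variable; for $n\ge1$, $Z_{n+1}=Z_n-\gamma_n\nabla_h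 g(X_{n+1},Z_n)$; and $\overline Z_n=\frac1n\sum_{k=1}^n Z_k$ (equivalently $\overline Z_1=Z_1$, $\overline Z_{n+1}=\overline Z_n+\frac1{n+1}(Z_{n+1}-\overline Z_n)$). *)

(* Defs.v *)
From HB Require Import structures.
From mathcomp Require Import all_boot all_order all_algebra finmap.
From mathcomp Require Import all_classical all_reals all_analysis.

Set Implicit Arguments.
Unset Strict Implicit.
Unset Printing Implicit Defensive.
Import Order.TTheory GRing.Theory Num.Theory.
Import numFieldNormedType.Exports.
Local Open Scope classical_set_scope.
Local Open Scope ring_scope.

Definition separable (T : topologicalType) : Prop :=
  exists2 D : set T, countable D & dense D.

(* A real Hilbert space is a complete normed space whose norm is induced by a
   dot product, i.e. a positive definite symmetric bilinear form. *)
Definition hilbert_dot (R : realType) (H : completeNormedModType R)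
    (dot : {dot H for idfun}) : Prop :=
  forall u : H, dot u u = `|u| ^+ 2.

Notation borel T := (g_sigma_algebraType (@open T)).

Section Probability.
Context {d d' : measure_display} {Omega : measurableType d}
  {T : measurableType d'} {R : realType}.

Definition mutually_independent (I : choiceType) (P : probability Omega R)
    (D : set I) (X : I -> Omega -> T) : Prop :=
  forall (J : {fset I}) (A : I -> set T),
    [set` J] `<=` D -> (forall i, measurable (A i)) ->
    P (\bigcap_(i in [set` J]) (X i @^-1` A i)) =
    (\prod_(i <- J) P (X i @^-1` A i))%E.

Definition same_law (P : probability Omega R) (X Y : {RV P >-> T}) : Prop :=
  forall A, measurable A -> distribution P X A = distribution P Y A.

(* sigma(X_1, ..., X_n); the sequence is indexed from 1, X_0 is not used. *)
Definition natural_filtration (X : nat -> Omega -> T) (n : nat) :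
    set (set Omega) :=
  <<s \bigcup_(k in [set k | (1 <= k <= n)%N])
        preimage_set_system setT (X k) measurable >>.

(* v = E[Y] for a random element Y of a separable Hilbert space: Y is Borel,
   E|Y| is finite, and v represents the linear form u |-> E<Y, u>. *)
Definition is_mean (H : completeNormedModType R) (dot : {dot H for idfun})
    (P : probability Omega R) (Y : Omega -> H) (v : H) : Prop :=
  [/\ measurable_fun setT (Y : Omega -> borel H),
      ('E_P[fun w => `|Y w|%R] < +oo)%E
    & forall u, 'E_P[fun w => dot (Y w) u] = (dot v u)%:E]%E.

End Probability.

Section Operators.
Context {R : realType} {H : completeNormedModType R}.
Implicit Types (T : H -> H) (dot : {dot H for idfun}).

(* Only meaningful for bounded T: [sup] of an unbounded set is 0. *)
Definition opnorm T : R := sup [set `|T u| | u in [set u | `|u| <= 1]].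

Definition is_gradient dot (f : H -> R) (h v : H) : Prop :=
  is_diff h f (dot v : H -> R).

(* Gam is the Hessian of a function with gradient field gradf, and depends on
   the base point continuously in operator norm. [is_diff] makes each [Gam h]
   linear and continuous, hence bounded; when [gradf] is a gradient field, the
   symmetry of second derivatives makes [Gam h] self-adjoint. *)
Definition continuous_hessian (gradf : H -> H) (Gam : H -> H -> H) : Prop :=
  (forall h, is_diff h gradf (Gam h)) /\
  (forall h, opnorm (Gam k \- Gam h) @[k --> h] --> (0 : R)).

Definition linear_span (B : set H) : set H :=
  [set v | exists (n : nat) (c : 'I_n -> R) (b : 'I_n -> H),
     (forall i, B (b i)) /\ v = \sum_(i < n) c i *: b i].

Definition orthonormal_basis dot (B : set H) : Prop :=
  [/\ forall u, B u -> dot u u = 1,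
      forall u v, B u -> B v -> u != v -> dot u v = 0
    & dense (linear_span B)].

Definition is_eigenvalue T (l : R) : Prop :=
  exists2 v : H, v != 0 & T v = l *: v.

Definition is_eigenvector T (v : H) : Prop :=
  v != 0 /\ exists l : R, T v = l *: v.

Definition has_eigenbasis dot T : Prop :=
  exists2 B, orthonormal_basis dot B & forall v, B v -> is_eigenvector T v.

(* Extended real valued, so that the infimum is +oo when H = {0}. *)
Definition eigen_inf T : \bar R :=
  ereal_inf [set l%:E | l in [set l | is_eigenvalue T l]].

End Operators.

(* Main.v *)
(* With T_n = Z_n - m, expanding |T_n - gamma_n grad|^(2p) to second order and
   freezing Z_n (the next observation is independent of it) bounds
   E|T_{n+1}|^(2p) by E|T_n|^(2p), minus a drift term, plus terms of size
   gamma_n^2.  Near m, hypothesis (iv) and the spectral gap of Gam m make the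
   drift quadratic; convexity of G keeps it at least linear in |T_n| far away.
   - Without the drift, sum gamma_n^2 < oo bounds all moments.
   - Truncating at |T_n| <= n^beta with beta small, the bounded higher moments
     give the crude rate E|T_n|^(2p) = O(n^(-(alpha - beta) p)) for all p.
   - Truncating at |T_n| <= 1, the crude rate for a larger p controls the far
     region and gives E|T_n|^(2p) = O(n^(-alpha p)).
   For the average, T_k is recovered from
     Gam m T_k = (T_k - T_{k+1}) / gamma_k + xi_k - delta_k,
   where xi_k is a martingale increment and delta_k = O(|T_k|^2).  After
   summation the first part is handled by parts, the third by the rate of T_k
   and alpha > 1/2, and the martingale by the same second order expansion. *)
Require Import Defs.
From HB Require Import structures.
From mathcomp Require Import all_boot all_order all_algebra finmap.
From mathcomp Require Import all_classical all_reals all_analysis.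
From mathcomp Require Import measurable_realfun ring lra zify.
Set Implicit Arguments.
Unset Strict Implicit.
Unset Printing Implicit Defensive.
Import Order.TTheory GRing.Theory Num.Theory.
Import numFieldNormedType.Exports.
Local Open Scope classical_set_scope.
Local Open Scope ring_scope.

(** * Elementary inequalities *)

(** The obstacle is that the drift is quadratic only near [m]: on a ball of radius A it is worth c/A
    times |T_n|^2. Truncation uses no events or indicators: the region |T_n| > A is charged to the
    moment of order 2(p+q) divided by A^(2q), with q free. Taking A = n^beta weakens the contraction
    to n^-(alpha+beta), which beats the 1/n relative decay of a power of n only if alpha + beta < 1;
    hence beta is small, and a second pass with A = 1 recovers the exponent alpha. The expansion
    also produces the next lower even moment with weight gamma_n^2. Young's inequality trades it for
    a small share of the current moment plus a constant, and this balance fixes the rate.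
    Conditional expectations are never formed: joint laws are products, so Tonelli integrates the
    new observation first. For the average, Jensen's inequality with weights k^(-1/2), whose sum is
    of order n^(1/2), yields n^p directly. Gam m is never inverted; the bound lam |v| <= |Gam m v|
    is applied to the summed errors. *)

Section real_inequalities.
Context {R : realType}.
Implicit Types (r t x a b c : R) (p q : nat).

(** With r = |u|, t = |v| and x = <v, u>, the base on the left is |u - v|^2. The term linear in x is
    kept exact, since its expectation is the drift; everything else carries a factor t^2. The
    induction multiplies the bound by this nonnegative base. *)
Lemma pow_sqdist_le p : exists2 C : R, 0 < C & forall r t x,
  0 <= r -> 0 <= t -> `|x| <= r * t ->
  (r ^+ 2 - 2 * x + t ^+ 2) ^+ p.+1 <=
  r ^+ (2 * p.+1) - 2 * p.+1%:R * r ^+ (2 * p) * x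
    + C * (t ^+ 2 * (r + t) ^+ (2 * p)).
Proof.
elim: p => [|p [C C0 IH]].
  exists 1 => // r t x r0 t0 _; rewrite muln0 !expr0 !mulr1 mul1r expr1 muln1.
  by lra.
(* With N = p+1, the cross terms of the product cost 1, 2N and 4N times [W], on top of the inherited
   C. *)
exists (C + 1 + 6 * p.+1%:R); first by have : 0 <= p.+1%:R :> R by []; lra.
move=> r t x r0 t0 xrt; have := IH r t x r0 t0 xrt.
have -> : (2 * p.+2 = 2 * p + 4)%N by lia.
have -> : (2 * p.+1 = 2 * p + 2)%N by lia.
rewrite !(exprD _ (2 * p)) [_ ^+ p.+2]exprS.
set Q := r ^+ (2 * p); set S := (r + t) ^+ (2 * p).
have Q0 : 0 <= Q by apply: exprn_ge0.
have QS : Q <= S by apply: lerXn2r; rewrite ?nnegrE ?addr_ge0 //; lra.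
set N : R := p.+1%:R; have N0 : 0 <= N by [].
have -> : p.+2%:R = N + 1 :> R by rewrite -(natr1 p.+1).
move: xrt; rewrite ler_norml => /andP[xl xr].
have B0 : 0 <= r ^+ 2 - 2 * x + t ^+ 2.
  by have := sqr_ge0 (r - t); rewrite sqrrB; lra.
have Bs : r ^+ 2 - 2 * x + t ^+ 2 <= (r + t) ^+ 2 by rewrite sqrrD; lra.
move=> /(ler_wpM2l B0) /le_trans; apply.
have x2 : x ^+ 2 <= r ^+ 2 * t ^+ 2.
  rewrite -exprMn -[x ^+ 2]real_normK ?num_real// lerXn2r ?nnegrE ?mulr_ge0//.
  by rewrite ler_norml; lra.
have r2 : 0 <= r ^+ 2 by apply: sqr_ge0.
have t2 : 0 <= t ^+ 2 by apply: sqr_ge0.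
have rt0 : 0 <= r * t by apply: mulr_ge0.
have s2 : r ^+ 2 <= (r + t) ^+ 2 by rewrite sqrrD; lra.
have rt2 : r * t <= (r + t) ^+ 2 by rewrite sqrrD; lra.
have S0 : 0 <= S by lra.
have h1 : t ^+ 2 * (Q * r ^+ 2) <= t ^+ 2 * (S * (r + t) ^+ 2).
  by apply: ler_wpM2l => //; apply: ler_pM => //; apply: sqr_ge0.
have h2 : t ^+ 2 * (Q * (r * t)) <= t ^+ 2 * (S * (r + t) ^+ 2).
  by apply: ler_wpM2l => //; apply: ler_pM => //; apply: mulr_ge0.
have h3 : - (t ^+ 2 * Q * x) <= t ^+ 2 * (Q * (r * t)).
  have := @ler_wpM2l _ (t ^+ 2 * Q) (mulr_ge0 t2 Q0) _ _ xl; lra.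
have h4 : Q * x ^+ 2 <= t ^+ 2 * (Q * r ^+ 2).
  have := ler_wpM2l Q0 x2; lra.
have h5 : (r ^+ 2 - 2 * x + t ^+ 2) * (t ^+ 2 * S) <= (r + t) ^+ 2 * (t ^+ 2 * S).
  by apply: ler_wpM2r => //; apply: mulr_ge0.
have k1 := ler_wpM2l (ltW C0) h5.
have k2 := ler_wpM2l N0 (le_trans h3 h2).
have k3 := ler_wpM2l N0 (le_trans h4 h1).
set W := t ^+ 2 * (S * (r + t) ^+ 2) in h1 h2 k2 k3 *.
have {}k1 : C * ((r ^+ 2 - 2 * x + t ^+ 2) * (t ^+ 2 * S)) <= C * W.
  by apply: le_trans k1 _; rewrite /W le_eqVlt; apply/orP; left; apply/eqP; ring.
have -> : (r ^+ 2 - 2 * x + t ^+ 2) *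
    (Q * r ^+ 2 - 2 * N * Q * x + C * (t ^+ 2 * S)) =
  Q * r ^+ 4 - 2 * (N + 1) * (Q * r ^+ 2) * x + (t ^+ 2 * (Q * r ^+ 2))
  + 2 * (N * (- (t ^+ 2 * Q * x))) + 4 * (N * (Q * x ^+ 2))
  + C * ((r ^+ 2 - 2 * x + t ^+ 2) * (t ^+ 2 * S)) by ring.
rewrite -/W; lra.
Qed.

(** According to whether a <= c b or not, one of the two terms on the right suffices alone. The free
    parameter c lets a lower moment be absorbed into the next one. *)
Lemma young_pow p a b c : 0 <= a -> 0 <= b -> 0 < c ->
  a * b ^+ p <= c * b ^+ p.+1 + c ^- p * a ^+ p.+1.
Proof.
move=> a0 b0 c0; have ci : 0 < c ^- p by rewrite invr_gt0 exprn_gt0.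
have [acb|cba] := leP a (c * b).
  rewrite (@le_trans _ _ (c * b ^+ p.+1))//.
    by rewrite exprS mulrA ler_wpM2r ?exprn_ge0.
  by rewrite lerDl mulr_ge0 ?exprn_ge0// ltW.
rewrite (@le_trans _ _ (c ^- p * a ^+ p.+1))//; last first.
  by rewrite lerDr mulr_ge0 ?exprn_ge0// ltW.
rewrite exprS mulrCA ler_wpM2l// -exprVn -exprMn lerXn2r ?nnegrE//.
  by rewrite mulr_ge0// invr_ge0 ltW.
by rewrite ler_pdivlMl// ltW.
Qed.

Lemma powD_le p a b : 0 <= a -> 0 <= b ->
  (a + b) ^+ p <= 2 ^+ p * (a ^+ p + b ^+ p).
Proof.
wlog ab : a b / a <= b => [H|] a0 b0.
  have [|/ltW] := leP a b => h; first exact: H.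
  by rewrite addrC [_ ^+ p + _]addrC; apply: H.
rewrite (@le_trans _ _ ((2 * b) ^+ p))//.
  by rewrite lerXn2r ?nnegrE; lra.
by rewrite exprMn ler_wpM2l ?exprn_ge0// lerDr exprn_ge0.
Qed.

Lemma pow_tangent_le q a b : 0 <= a -> 0 <= b ->
  a ^+ q.+1 + q.+1%:R * a ^+ q * (b - a) <= b ^+ q.+1.
Proof.
move=> a0 b0; elim: q => [|q IH]; first by rewrite !expr1 expr0; lra.
have := ler_wpM2l b0 IH; rewrite -exprS; apply: le_trans.
rewrite -(natr1 q.+1) [a ^+ q.+2]exprS [a ^+ q.+1]exprS.
set N : R := q.+1%:R; have N0 : 0 <= N by [].
have Q0 : 0 <= a ^+ q by apply: exprn_ge0.
rewrite -subr_ge0.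
have -> : b * (a * a ^+ q + N * a ^+ q * (b - a)) -
   (a * (a * a ^+ q) + (N + 1) * (a * a ^+ q) * (b - a)) =
   N * a ^+ q * (b - a) ^+ 2 by ring.
by rewrite mulr_ge0 ?sqr_ge0// mulr_ge0.
Qed.

(** Convexity enters through the tangent at the weighted mean [a] = S/W, where the linear terms
    cancel. The weights are not normalized, so the case of total weight 0 is separate. *)
Lemma jensen_pow (I : Type) (s : seq I) (w y : I -> R) q :
  (forall i, 0 <= w i) -> (forall i, 0 <= y i) ->
  (\sum_(i <- s) w i * y i) ^+ q.+1 <=
  (\sum_(i <- s) w i) ^+ q * \sum_(i <- s) w i * y i ^+ q.+1.
Proof.
move=> w0 y0; set W := \sum_(i <- s) w i; set S := \sum_(i <- s) w i * y i.
have W0 : 0 <= W by apply: sumr_ge0.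
have S0 : 0 <= S by apply: sumr_ge0 => i _; apply: mulr_ge0.
have [W_eq0|W_neq0] := eqVneq W 0.
  have wz i : w i * y i <= w i * 0 + w i * (y i + 1) by have := w0 i; have := y0 i; nra.
  suff -> : S = 0.
    by rewrite exprS mul0r mulr_ge0 ?exprn_ge0 ?sumr_ge0// => i _; rewrite mulr_ge0 ?exprn_ge0.
  apply/eqP; rewrite eq_le S0 andbT /S; move: W_eq0; rewrite /W.
  elim: s {W S W0 S0} => [|i s IH]; first by rewrite !big_nil.
  rewrite !big_cons => /eqP; rewrite paddr_eq0 ?sumr_ge0// => /andP[/eqP -> /eqP /IH].
  by rewrite mul0r add0r.
have {}W0 : 0 < W by rewrite lt_def W_neq0.
pose a := S / W; have a0 : 0 <= a by rewrite divr_ge0// ltW.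
have h : W * a ^+ q.+1 <= \sum_(i <- s) w i * y i ^+ q.+1.
  apply: (@le_trans _ _ (\sum_(i <- s) w i * (a ^+ q.+1 + q.+1%:R * a ^+ q * (y i - a)))).
    have Wa : W * a = S by rewrite /a mulrCA mulfV// mulr1.
    rewrite (eq_bigr (fun i => a ^+ q.+1 * w i +
      (q.+1%:R * a ^+ q * (w i * y i) - q.+1%:R * a ^+ q * a * w i))); last first.
      by move=> i _; ring.
    rewrite big_split sumrB -!mulr_sumr -/W -/S -Wa le_eqVlt; apply/orP; left.
    by apply/eqP; rewrite /=; ring.
  by apply: ler_sum => i _; rewrite ler_wpM2l// pow_tangent_le.
have -> : S = W * a by rewrite /a mulrCA mulfV// mulr1.
have := ler_wpM2l (exprn_ge0 q (ltW W0)) h; apply: le_trans.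
by rewrite exprMn exprS mulrA [W ^+ q * W]mulrC.
Qed.

End real_inequalities.

(** * Hilbert space geometry *)

Section hilbert.
Context {R : realType} {H : completeNormedModType R} (dot : {dot H for idfun}).
Context (dotE : hilbert_dot dot).
Implicit Types u v w : H.

Lemma dotC u v : dot u v = dot v u.
Proof. by rewrite hermC expr0 mul1r. Qed.

Lemma dotBl u v w : dot (u - v) w = dot u w - dot v w.
Proof. by rewrite linearBl. Qed.

Lemma dotBr u v w : dot u (v - w) = dot u v - dot u w.
Proof. by rewrite linearBr. Qed.

Lemma dotZl (a : R) u v : dot (a *: u) v = a * dot u v.
Proof. by rewrite linearZl_LR. Qed.

Lemma dotZr (a : R) u v : dot u (a *: v) = a * dot u v.
Proof. by rewrite linearZr_LR. Qed.

Lemma dot_suml (I : Type) (s : seq I) (f : I -> H) v :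
  dot (\sum_(i <- s) f i) v = \sum_(i <- s) dot (f i) v.
Proof. exact: linear_sumlz. Qed.

Lemma dot_sum (I : Type) (s : seq I) (f g : I -> H) :
  dot (\sum_(i <- s) f i) (\sum_(i <- s) g i) =
  \sum_(i <- s) \sum_(j <- s) dot (f i) (g j).
Proof.
rewrite dot_suml; apply: eq_bigr => i _; rewrite dotC dot_suml.
by apply: eq_bigr => j _; exact: dotC.
Qed.

Lemma sqr_norm_sub u v : `|u - v| ^+ 2 = `|u| ^+ 2 - 2 * dot v u + `|v| ^+ 2.
Proof.
rewrite -!dotE dotBl !dotBr (dotC u v); ring.
Qed.

Lemma dot_cauchy_schwarz u v : `|dot u v| <= `|u| * `|v|.
Proof.
have [->|v0] := eqVneq v 0; first by rewrite linear0r !normr0 mulr0.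
have nv : 0 < `|v| by rewrite normr_gt0.
have h : `|dot u v| ^+ 2 <= (`|u| * `|v|) ^+ 2.
  rewrite real_normK ?num_real//.
  have := sqr_ge0 `|u - (dot u v / `|v| ^+ 2) *: v|.
  rewrite sqr_norm_sub dotZl (dotC v u) normrZ exprMn real_normK ?num_real//.
  set a := dot u v => h.
  have := @ler_wpM2r _ (`|v| ^+ 2) (sqr_ge0 _) _ _ h; rewrite mul0r.
  have -> : (`|u| ^+ 2 - 2 * (a / `|v| ^+ 2 * a) + (a / `|v| ^+ 2) ^+ 2 * `|v| ^+ 2)
      * `|v| ^+ 2 = `|u| ^+ 2 * `|v| ^+ 2 - a ^+ 2 by field; rewrite gt_eqF.
  by rewrite subr_ge0 exprMn.
by rewrite -(@ler_pXn2r _ 2)// nnegrE mulr_ge0.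
Qed.

Lemma pow_norm_sub_le p : exists2 C : R, 0 < C & forall u v,
  `|u - v| ^+ (2 * p.+1) <=
  `|u| ^+ (2 * p.+1) - 2 * p.+1%:R * `|u| ^+ (2 * p) * dot v u
    + C * (`|u| ^+ (2 * p) * `|v| ^+ 2 + `|v| ^+ (2 * p.+1)).
Proof.
have [C C0 HC] := @pow_sqdist_le R p.
exists (C * 2 ^+ (2 * p)); first by rewrite mulr_gt0// exprn_gt0.
move=> u v; rewrite exprM sqr_norm_sub.
have duv : `|dot v u| <= `|u| * `|v| by rewrite mulrC dot_cauchy_schwarz.
have := HC `|u| `|v| (dot v u) (normr_ge0 _) (normr_ge0 _) duv.
move=> /le_trans; apply; rewrite lerD2l -mulrA ler_wpM2l ?(ltW C0)//.
have := ler_wpM2l (sqr_ge0 `|v|)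
  (@powD_le R (2 * p) `|u| `|v| (normr_ge0 _) (normr_ge0 _)).
by rewrite (mulnS 2 p) (exprD _ 2) mulrCA mulrDr (mulrC (_ ^+ 2) (`|u| ^+ _)).
Qed.

Lemma continuous_dot (f g : H -> H) u :
  {for u, continuous f} -> {for u, continuous g} ->
  {for u, continuous (fun v => dot (f v) (g v))}.
Proof.
move=> cf cg.
(* Polarization reduces continuity of the dot product to that of the norm. *)
have h w1 w2 : dot w1 w2 = (`|w1| ^+ 2 + `|w2| ^+ 2 - `|w1 - w2| ^+ 2) / 2.
  by rewrite sqr_norm_sub (dotC w1 w2); lra.
rewrite (_ : (fun v => _) = (fun v => (`|f v| ^+ 2 + `|g v| ^+ 2 - `|f v - g v| ^+ 2) / 2)); last first.
  by apply/funext => v; rewrite h.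
have sq (k : H -> H) : {for u, continuous k} -> {for u, continuous (fun v => `|k v| ^+ 2)}.
  move=> ck; apply: (@continuous_comp _ _ _ k (fun v => `|v| ^+ 2)) => //.
  apply: (@continuous_comp _ _ _ (fun v : H => `|v|) (fun x : R => x ^+ 2)).
    exact: norm_continuous.
  exact: exprn_continuous.
apply: cvgM; last exact: cvg_cst.
apply: cvgB; first by apply: cvgD; apply: sq.
apply: sq; exact: cvgB.
Qed.

(* With l the eigenvalue map on the basis, <T v, v> - lam |v|^2 is the squared
   norm of sum_i sqrt (l (b i) - lam) c i b i when v = sum_i c i b i; this
   avoids collecting repeated basis vectors. *)
Lemma eigenbasis_coercive (T : {linear H -> H}) (lam : R) :
  continuous T -> has_eigenbasis dot T ->
  (forall l, is_eigenvalue T l -> lam <= l) ->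
  forall v, lam * `|v| ^+ 2 <= dot (T v) v.
Proof.
move=> cT [B [B1 B2 dB] BT] lamP.
have /choice[l lP] : forall b, exists l : R, B b -> T b = l *: b /\ lam <= l.
  move=> b; have [Bb|nBb] := pselect (B b); last by exists 0.
  have [b0 [l Tb]] := BT b Bb; exists l => _; split => //.
  by apply: lamP; exists b.
have spanP v : linear_span B v -> lam * `|v| ^+ 2 <= dot (T v) v.
  move=> [n [c [b [Bb ->]]]].
  set s := \sum_(i < n) Num.sqrt (l (b i) - lam) *: (c i *: b i).
  suff E : dot (T (\sum_(i < n) c i *: b i)) (\sum_(i < n) c i *: b i) -
      lam * `|\sum_(i < n) c i *: b i| ^+ 2 = dot s s.
    by rewrite -subr_ge0 E dotE sqr_ge0.
  have -> : T (\sum_(i < n) c i *: b i) = \sum_(i < n) c i *: T (b i).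
    by rewrite linear_sum; apply: eq_bigr => i _; rewrite linearZ.
  rewrite -dotE /s !dot_sum mulr_sumr -sumrB; apply: eq_bigr => i _.
  rewrite mulr_sumr -sumrB; apply: eq_bigr => j _.
  have [Tbi li] := lP _ (Bb i); rewrite Tbi !dotZl !dotZr.
  have [bij|bij] := eqVneq (b i) (b j).
    rewrite -bij; have := @sqr_sqrtr _ (l (b i) - lam); rewrite subr_ge0 => /(_ li).
    set q := Num.sqrt _ => q2; rewrite (_ : q * _ = q ^+ 2 * (c i * (c j * dot (b i) (b i)))).
      by rewrite q2; ring.
    by ring.
  by rewrite (B2 _ _ (Bb i) (Bb j) bij) !mulr0 subr0.
move=> v.
(* Both sides are continuous, so the inequality extends from the dense span of the basis to all of
   H. *)
have cl : closed [set w | 0 <= dot (T w) w - lam * `|w| ^+ 2].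
  apply: (@closed_comp _ _ (fun w => dot (T w) w - lam * `|w| ^+ 2) [set x | 0 <= x]); last exact: closed_ge.
  move=> w _; apply: cvgB; first by apply: (continuous_dot (f := T) (g := id)); [exact: cT|exact: cvg_id].
  apply: cvgM; first exact: cvg_cst.
  apply: (@continuous_comp _ _ _ (fun v : H => `|v|) (fun x : R => x ^+ 2)).
    exact: norm_continuous.
  exact: exprn_continuous.
rewrite -subr_ge0.
apply: (cl v) => U vU.
have [V [oV Vv VU]] : exists V, [/\ open V, V v & V `<=` U].
  by move: vU; rewrite nbhsE => -[V [oV Vv] VU]; exists V.
have [w [Vw sw]] := dB V (ex_intro _ v Vv) oV.
by exists w; split; [rewrite /= subr_ge0; exact: spanP|exact: VU].
Qed.

End hilbert.

(** * Drift and linearization of the gradient of a convex function *)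

Section objective.
Context {R : realType} {H : completeNormedModType R} (dot : {dot H for idfun}).
Context (dotE : hilbert_dot dot).

Lemma convex_gradient_le (G : H -> R) (a b v : H) :
  convex_function [set: convex_lmodType H] G -> is_gradient dot G a v ->
  G a + dot v (b - a) <= G b.
Proof.
move=> cG gG.
have [dG dGE] := gG.
have : 'D_(b - a) G a = dot v (b - a) by rewrite deriveE// dGE.
have := @diff_derivable _ _ _ G a (b - a) dG.
rewrite /derivable => /cvg_dnbhs_at_right cv; rewrite /derive => E.
rewrite E in cv.
suff : dot v (b - a) <= G b - G a by lra.
(* Convexity bounds every right difference quotient at 0 along the segment by G b - G a, so the
   limit is bounded too. *)
apply: (cvgr_to_le cv).
near=> t.
have t0 : 0 < t by near: t; exact: nbhs_right_gt.
have t1 : t <= 1 by near: t; exact: nbhs_right_le.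
have t01 : 0 <= t <= 1 by rewrite ltW.
have Gle : G (t *: b + (1 - t) *: a) <= t * G b + (1 - t) * G a.
  exact: (cG (Itv01 (ltW t0) t1) b a (mem_setT _) (mem_setT _)).
rewrite /=.
have -> : t *: (b - a) + a = t *: b + (1 - t) *: a.
  by rewrite scalerBr scalerBl scale1r addrA addrAC [_ + a]addrC addrA.
by rewrite ler_pdivrMl//; lra.
Unshelve. all: by end_near.
Qed.

Lemma gradient_monotone (G : H -> R) (gradG : H -> H) (a b : H) :
  convex_function [set: convex_lmodType H] G ->
  (forall h, is_gradient dot G h (gradG h)) ->
  dot (gradG b) (a - b) <= dot (gradG a) (a - b).
Proof.
move=> cG gG; have h1 := convex_gradient_le b cG (gG a).
have h2 := convex_gradient_le a cG (gG b).
by move: h1; rewrite -opprB linearNr/=; lra.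
Qed.

(** Within a small radius e the quadratic form dominates the cubic remainder. Farther out,
    monotonicity of the gradient along the ray from [m] compares h with the point at distance e,
    giving a bound lam/2 * e * r linear in r = |h - m|; it exceeds c/A * r^2 as long as r <= A. *)
Lemma gradient_lower_bound (G : H -> R) (gradG : H -> H) (T : H -> H) (m : H)
    (lam eps C : R) :
  convex_function [set: convex_lmodType H] G ->
  (forall h, is_gradient dot G h (gradG h)) -> gradG m = 0 ->
  0 < lam -> (forall v, lam * `|v| ^+ 2 <= dot (T v) v) ->
  0 < eps -> 0 < C ->
  (forall h, `|h - m| <= eps -> `|gradG h - T (h - m)| <= C * `|h - m| ^+ 2) ->
  exists2 c : R, 0 < c & forall A h, 1 <= A -> `|h - m| <= A ->
    c / A * `|h - m| ^+ 2 <= dot (gradG h) (h - m).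
Proof.
move=> cG gG Gm lam0 lamP eps0 C0 TP.
(* The three constraints serve the remainder bound, the inequality e/A <= 1, and the absorption of
   the cubic term C r^3 by half of lam r^2. *)
pose e := Num.min (Num.min eps 1) (lam / (2 * C)).
have e0 : 0 < e by rewrite !lt_min eps0 ltr01 divr_gt0// mulr_gt0.
have [ee e1 eC] : [/\ e <= eps, e <= 1 & e <= lam / (2 * C)].
  by rewrite /e; split; rewrite !ge_min lexx ?orbT.
have near h : `|h - m| <= e -> lam / 2 * `|h - m| ^+ 2 <= dot (gradG h) (h - m).
  move=> he; have := TP h (le_trans he ee); set u := h - m in he *; move=> Tu.
  have : `|dot (gradG h - T u) u| <= C * `|u| ^+ 2 * `|u|.
    apply: le_trans (dot_cauchy_schwarz dotE _ _) _.
    by rewrite ler_wpM2r.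
  rewrite ler_norml dotBl => /andP[lb _].
  have := lamP u.
  have : C * `|u| ^+ 2 * `|u| <= lam / 2 * `|u| ^+ 2.
    rewrite mulrAC ler_wpM2r ?sqr_ge0//.
    have := ler_wpM2l (ltW C0) (le_trans he eC).
    by rewrite (_ : C * (lam / (2 * C)) = lam / 2)//; field; rewrite gt_eqF.
  lra.
exists (lam / 2 * e); first by rewrite mulr_gt0// divr_gt0.
move=> A h A1 hA; set r := `|h - m|; have r0 : 0 <= r by exact: normr_ge0.
have A0 : 0 < A by lra.
have Ai : A^-1 <= 1 by rewrite invf_le1.
have [he|he] := leP r e.
  apply: le_trans (near h he); rewrite ler_wpM2r ?sqr_ge0//.
  rewrite -[leRHS]mulr1 -(mulrA (lam / 2)).
  by apply: ler_wpM2l; [lra|apply: mulr_ile1 => //; rewrite ?invr_ge0 ltW].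
have rp : 0 < r by lra.
(* The point where the segment from [m] to h meets the sphere of radius e. *)
pose b := m + (e / r) *: (h - m).
have bm : b - m = (e / r) *: (h - m) by rewrite /b addrAC subrr add0r.
have nb : `|b - m| = e.
  by rewrite bm normrZ ger0_norm ?divr_ge0// ?ltW// -mulrA mulVf ?mulr1// gt_eqF.
have := near b; rewrite nb => /(_ (lexx _)).
have := gradient_monotone h b cG gG.
have -> : h - b = (1 - e / r) *: (h - m).
  by rewrite /b opprD addrA scalerBl scale1r.
have q0 : 0 < 1 - e / r by rewrite subr_gt0 ltr_pdivrMr// mul1r.
rewrite !dotZr ler_pM2l// bm dotZr => mon.
move=> lb0; have := ler_wpM2l (ltW (divr_gt0 rp e0)) lb0; rewrite [leRHS]mulrA.
rewrite (_ : r / e * (lam / 2 * e ^+ 2) = lam / 2 * e * r); last by field; rewrite gt_eqF.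
have -> : r / e * (e / r) = 1 by field; rewrite !gt_eqF.
rewrite mul1r => lb; apply: (le_trans _ mon); apply: le_trans lb.
rewrite -mulrA; apply: ler_wpM2l; first by rewrite mulr_ge0// ltW// divr_gt0.
by rewrite ler_pdivrMl// expr2 mulrC ler_wpM2r// mulrC.
Qed.

(** Beyond distance eps, 1 <= r^2/eps^2 and r <= r^2/eps, so linear growth is already quadratic.
    Making the local estimate global allows the linearization to be summed along the whole
    trajectory. *)
Lemma linear_remainder_quadratic (gradG T : H -> H) (m : H) (L B eps C : R) :
  (forall v, `|T v| <= B * `|v|) -> 0 < B ->
  0 < L -> (forall h, `|gradG h| <= L * (1 + `|h - m|)) ->
  0 < eps -> 0 < C ->
  (forall h, `|h - m| <= eps -> `|gradG h - T (h - m)| <= C * `|h - m| ^+ 2) ->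
  exists2 C', 0 < C' & forall h, `|gradG h - T (h - m)| <= C' * `|h - m| ^+ 2.
Proof.
move=> TB B0 L0 GL e0 C0 near.
exists (C + L / eps ^+ 2 + (L + B) / eps).
  by rewrite !addr_gt0 ?divr_gt0 ?exprn_gt0 ?addr_gt0.
move=> h; set r := `|h - m|; have r0 : 0 <= r by exact: normr_ge0.
have Le : 0 <= L / eps ^+ 2 * r ^+ 2 by rewrite mulr_ge0 ?divr_ge0 ?sqr_ge0 ?ltW.
have LBe : 0 <= (L + B) / eps * r ^+ 2.
  by rewrite mulr_ge0 ?divr_ge0 ?sqr_ge0 ?addr_ge0 ?ltW.
have [he|he] := leP r eps.
  by apply: le_trans (near h he) _; rewrite -/r !mulrDl; lra.
apply: le_trans (ler_normB _ _) _.
have := GL h; have := TB (h - m); rewrite -/r => h1 h2.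
have h3 : L <= L / eps ^+ 2 * r ^+ 2.
  rewrite mulrAC ler_pdivlMr ?exprn_gt0// ler_wpM2l ?ltW//.
  by rewrite ltrXn2r ?nnegrE// ltW.
have h4 : (L + B) * r <= (L + B) / eps * r ^+ 2.
  rewrite mulrAC ler_pdivlMr// expr2 mulrA ler_wpM2l ?mulr_ge0 ?addr_ge0// ltW//.
have h5 : 0 <= C * r ^+ 2 by rewrite mulr_ge0 ?sqr_ge0 ?ltW.
lra.
Qed.

End objective.

(** * Measurability in a separable Hilbert space *)

Section borel_separable.
Context {R : realType} {H : completeNormedModType R}.
Context (Hsep : separable H).

Lemma dense_sequence : exists e : nat -> H, forall (x : H) (r : R), 0 < r ->
  exists i, ball (e i) r x.
Proof.
have [D /countable_injP[k kinj] dD] := Hsep.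
(* [k] injects D into the integers and this is its inverse; indices that are not attained get the
   harmless value 0. *)
exists (fun i => xget 0 [set a | D a /\ k a = i]) => x r r0.
have [a [xa Da]] := dD (ball x r) (ex_intro _ x (ballxx x r0)) (ball_open x r).
exists (k a); case: xgetP => [b _ [Db kb]|/(_ a)]; last by move=> h; exfalso; apply: h.
suff -> : b = a by apply: ball_sym.
by apply: kinj => //; rewrite inE.
Qed.

(** Separability makes every open set of the product a countable union of products of balls, hence
    measurable for the product of the Borel sigma-algebras. Sums and differences of random elements
    are measurable for this reason. *)
Lemma open_prod_measurable (U : set (H * H)) :
  open U -> measurable (U : set (borel H * borel H)).
Proof.
move=> oU; have [e eP] := dense_sequence.
pose rad n : R := n.+1%:R^-1.
pose box (k : nat * nat * nat) : set (H * H) :=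
  ball (e k.1.1) (rad k.2) `*` ball (e k.1.2) (rad k.2).
pose F k := if `[< box k `<=` U >] then box k else set0.
have -> : U = \bigcup_k F k.
  apply/seteqP; split => [[x y] Uxy|z [k _]]; last first.
    by rewrite /F; case: asboolP => // h /h.
  have /nbhs_ballP[r /= r0 rU] : nbhs (x, y) U by exact: open_nbhs_nbhs.
  have [n _ nr] : exists2 n, True & rad n < r / 2.
    have [n _ nP] := @near_infty_natSinv_lt R (PosNum (divr_gt0 r0 (ltr0n _ 2))).
    by exists n => //; exact: (nP n (leqnn n)).
  have n0 : 0 < rad n by rewrite invr_gt0.
  have [i ix] := eP x _ n0; have [j jy] := eP y _ n0.
  exists (i, j, n) => //; rewrite /F; case: asboolP => //; case => -[u v] [/= iu jv].
  apply: rU; have hr : rad n + rad n <= r by lra.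
  split; apply: (le_ball hr); [apply: (ball_triangle _ iu)|apply: (ball_triangle _ jv)];
    exact: ball_sym.
apply: countable_bigcupT_measurable; first exact: countableP.
move=> k; rewrite /F; case: asboolP => _ //.
by apply: measurableX; apply: sub_sigma_algebra; apply: ball_open; rewrite invr_gt0.
Qed.

Lemma borel_measurability d (T : measurableType d) (f : T -> borel H) :
  (forall U : set H, open U -> measurable (f @^-1` U)) -> measurable_fun setT f.
Proof.
move=> mf; apply: (@measurability _ _ T (borel H) setT f (@open H) erefl).
by move=> _ [U oU <-]; rewrite setTI; exact: mf.
Qed.

Lemma continuous_borel_measurable (f : H -> H) :
  continuous f -> measurable_fun setT (f : borel H -> borel H).
Proof.
move=> /continuousP cf; apply: borel_measurability => U oU.
by apply: sub_sigma_algebra; exact: cf.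
Qed.

Lemma continuous_real_measurable (f : H -> R) :
  continuous f -> measurable_fun setT (f : borel H -> R).
Proof.
move=> /continuousP cf; apply: (measurability _ (measurable_realfun.RGenOpens.measurableE R)).
move=> _ [_ [a [b ->] <-]]; rewrite setTI; apply: sub_sigma_algebra.
exact/cf/interval_open.
Qed.

Context {d : measure_display} {T : measurableType d}.
Implicit Types f g : T -> borel H.

Lemma measurable_fun_pair_continuous (h : H -> H -> H) f g :
  continuous (fun z : H * H => h z.1 z.2) ->
  measurable_fun setT f -> measurable_fun setT g ->
  measurable_fun setT ((fun x => h (f x) (g x)) : T -> borel H).
Proof.
move=> /continuousP ch mf mg.
have mh : measurable_fun setT ((fun z => h z.1 z.2) : borel H * borel H -> borel H).
  by apply: borel_measurability => U oU; apply: open_prod_measurable; exact: ch.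
exact: (measurableT_comp mh (measurable_fun_pair mf mg)).
Qed.

Lemma borel_measurable_add f g : measurable_fun setT f -> measurable_fun setT g ->
  measurable_fun setT ((fun x => (f x : H) + (g x : H)) : T -> borel H).
Proof.
apply: (measurable_fun_pair_continuous (h := fun u v => u + v)).
exact: add_continuous.
Qed.

Lemma borel_measurable_scale (a : R) f : measurable_fun setT f ->
  measurable_fun setT ((fun x => a *: (f x : H)) : T -> borel H).
Proof.
move=> mf; apply: (measurableT_comp _ mf).
by apply: continuous_borel_measurable; exact: scaler_continuous.
Qed.

Lemma borel_measurable_sub f g : measurable_fun setT f -> measurable_fun setT g ->
  measurable_fun setT ((fun x => (f x : H) - (g x : H)) : T -> borel H).
Proof.
move=> mf mg.
rewrite (_ : (fun x => _) = (fun x => (f x : H) + ((-1) *: (g x : H)))); last first.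
  by apply/funext => x; rewrite scaleN1r.
by apply: borel_measurable_add => //; exact: borel_measurable_scale.
Qed.

Lemma borel_measurable_norm f : measurable_fun setT f ->
  measurable_fun setT ((fun x => `|f x : H|) : T -> R).
Proof.
move=> mf; apply: (measurableT_comp _ mf).
by apply: continuous_real_measurable; exact: norm_continuous.
Qed.

Lemma borel_measurable_sum (I : eqType) (s : seq I) (h : I -> T -> borel H) :
  (forall i, i \in s -> measurable_fun setT (h i)) ->
  measurable_fun setT ((fun x => \sum_(i <- s) (h i x : H)) : T -> borel H).
Proof.
elim: s => [|i s IH] mh.
  rewrite (_ : (fun x => _) = cst (0 : H)); first exact: measurable_cst.
  by apply/funext => x; rewrite big_nil.
rewrite (_ : (fun x => _) = fun x => (h i x : H) + \sum_(j <- s) (h j x : H)).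
  apply: borel_measurable_add; first by apply: mh; rewrite inE eqxx.
  by apply: IH => j js; apply: mh; rewrite inE js orbT.
by apply/funext => x; rewrite big_cons.
Qed.

Lemma borel_measurable_dot (dot : {dot H for idfun}) f g : hilbert_dot dot ->
  measurable_fun setT f -> measurable_fun setT g ->
  measurable_fun setT ((fun x => dot (f x) (g x)) : T -> R).
Proof.
move=> dotE mf mg.
rewrite (_ : (fun x => _) = fun x =>
    2^-1 * (`|f x : H| ^+ 2 + `|g x : H| ^+ 2 - `|(f x : H) - (g x : H)| ^+ 2)).
  apply: measurable_funM; first exact: measurable_cst.
  by apply: measurable_funB; first apply: measurable_funD; apply: measurable_funX;
    apply: borel_measurable_norm => //; exact: borel_measurable_sub.
by apply/funext => x; rewrite (sqr_norm_sub dotE) (dotC dot (f x)); lra.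
Qed.

End borel_separable.

(** * Independence and freezing *)

Section independence.
Context {d d' : measure_display} {Omega : measurableType d} {T : measurableType d'}
  {R : realType} (P : probability Omega R).
Local Open Scope ereal_scope.

(** The lambda-system half of the pi-lambda argument that extends independence from cylinders to the
    generated sigma-algebra. *)
Lemma dynkin_indep (E : set Omega) : measurable E ->
  dynkin [set A | measurable A /\ P (A `&` E) = P A * P E].
Proof.
move=> mE; split.
- by split => //; rewrite setTI probability_setT mul1e.
- move=> A [mA PA]; split; first exact: measurableC.
  have -> : P (~` A `&` E) = P E - P (A `&` E).
    have -> : ~` A `&` E = E `\` (A `&` E).
      by apply/seteqP; split => w [h1 h2]; split => //; [case|move=> Aw; apply: h2].
    rewrite measureD//; [|exact: measurableI|by rewrite ltey_eq fin_num_measure].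
    by rewrite setICA setIid.
  rewrite PA probability_setC//.
  rewrite -(@fineK _ (P A)) ?fin_num_measure// -(@fineK _ (P E)) ?fin_num_measure//.
  by rewrite -EFinM -!EFinB -EFinM; congr (_%:E); ring.
- move=> F tF FD; split; first by apply: bigcupT_measurable => i; case: (FD i).
  rewrite setI_bigcupl measure_bigcup//; last 2 first.
    by move=> i _; apply: measurableI => //; case: (FD i).
    exact: trivIset_setIr.
  rewrite measure_bigcup//; last by move=> i _; case: (FD i).
  rewrite -(@fineK _ (P E)) ?fin_num_measure// muleC -nneseriesZl//.
  apply: eq_eseriesr => i _; have [_ PFi] := FD i.
  rewrite [LHS]PFi fineK ?fin_num_measure//; exact: muleC.
Qed.

Lemma natural_filtration_measurable (X : nat -> {RV P >-> T}) n :
  natural_filtration (fun k => X k : Omega -> T) n `<=` measurable.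
Proof.
apply: smallest_sub; first exact: sigma_algebra_measurable.
move=> _ [k _ [B mB <-]]; exact: measurable_funP.
Qed.

Lemma indep_natural_filtration (X : nat -> {RV P >-> T}) :
  mutually_independent P [set n | (1 <= n)%N] (fun n => X n : Omega -> T) ->
  forall n A B, natural_filtration (fun k => X k : Omega -> T) n A ->
    measurable B ->
    P (A `&` X n.+1 @^-1` B) = P A * P (X n.+1 @^-1` B).
Proof.
move=> Xind n A B FA mB.
pose J : {fset nat} := [fset k in iota 1 n]%fset.
have JE k : (k \in J) = (1 <= k <= n)%N by rewrite !inE mem_iota add1n ltnS.
(* Cylinders over the indices 1, ..., n: stable under intersection, and generating the filtration at
   n. *)
pose Pi : set (set Omega) := [set A | exists2 F : nat -> set T,
  forall k, measurable (F k) & A = \bigcap_(k in [set` J]) (X k @^-1` F k)].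
have PiI : setI_closed Pi.
  move=> _ _ [F mF ->] [F' mF' ->]; exists (fun k => F k `&` F' k).
    by move=> k; exact: measurableI.
  apply/seteqP; split => w.
    by move=> [h1 h2] k kJ; split; [exact: h1|exact: h2].
  by move=> h; split => k kJ; case: (h k kJ).
pose E := X n.+1 @^-1` B.
have mE : measurable E by exact: measurable_funPTI.
suff : <<d Pi>> `<=` [set A | measurable A /\ P (A `&` E) = P A * P E].
  rewrite setI_closed_g_dynkin_g_sigma_algebra// => /(_ A)[]//.
  move: A FA; apply: smallest_sub; first exact: smallest_sigma_algebra.
  move=> _ [k /= kn [C mC <-]]; apply: sub_sigma_algebra.
  exists (fun i => if i == k then C else setT) => [i|]; first by case: ifP.
  rewrite setTI; apply/seteqP; split => w.
    by move=> Cw i _; case: ifPn => [/eqP ->|].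
  by move=> /(_ k); rewrite /= eqxx; apply; rewrite JE.
apply: smallest_sub; first exact: dynkin_indep.
move=> _ [F mF ->]; split.
  apply: bigcap_measurableType => k _; exact: measurable_funPTI.
(* A cylinder intersected with an event on the next observation is a cylinder over one more index,
   to which mutual independence applies. *)
pose F' k := if k == n.+1 then B else F k.
have F'J k : k \in J -> F' k = F k.
  by rewrite JE /F' => /andP[_ kn]; case: eqP => // kE; move: kn; rewrite kE ltnn.
have nJ : n.+1 \notin J by rewrite JE ltnn andbF.
have mF' k : measurable (F' k) by rewrite /F'; case: ifP.
have sub : [set` (n.+1 |` J)%fset] `<=` [set n | (1 <= n)%N].
  by move=> k /=; rewrite in_fset1U JE => /orP[/eqP ->//|/andP[]].
have := Xind (n.+1 |` J)%fset F' sub mF'.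
have -> : \bigcap_(i in [set` (n.+1 |` J)%fset]) (X i @^-1` F' i) =
    (\bigcap_(k in [set` J]) (X k @^-1` F k)) `&` E.
  apply/seteqP; split => w.
    move=> h; split; last by have := h n.+1; rewrite /= fset1U1 /F' eqxx; exact.
    by move=> k kJ; have := h k; rewrite /= fset1Ur// F'J//; exact.
  move=> [h1 h2] k /=; rewrite in_fset1U => /orP[/eqP ->|kJ].
    by rewrite /F' eqxx.
  by rewrite F'J//; exact: h1.
rewrite big_fsetU1//= /F' eqxx muleC => ->; congr (_ * _).
rewrite Xind//; last by move=> k /=; rewrite JE => /andP[].
by rewrite !big_seq; apply: eq_bigr => k kJ; have := F'J k kJ; rewrite /F' => ->.
Qed.

End independence.

Section fubini_independent.
Context {d d1 d2 : measure_display} {Omega : measurableType d}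
  {T1 : measurableType d1} {T2 : measurableType d2}
  {R : realType} (P : probability Omega R).
Local Open Scope ereal_scope.

(** Independence on rectangles identifies the joint law with the product law, and Tonelli then
    integrates over U with W frozen. *)
Lemma integral_indep (U : {RV P >-> T1}) (W : {RV P >-> T2}) (f : T1 * T2 -> \bar R) :
  (forall A B, measurable A -> measurable B ->
    P (U @^-1` A `&` W @^-1` B) = P (U @^-1` A) * P (W @^-1` B)) ->
  measurable_fun setT f -> (forall z, 0 <= f z) ->
  \int[P]_w f (U w, W w) = \int[P]_w \int[distribution P U]_x f (x, W w).
Proof.
move=> UW mf f0.
have mUW : measurable_fun setT (fun w => (U w, W w)).
  by apply: measurable_fun_pair; exact: measurable_funP.
pose UWm := isMeasurableFun.Build _ _ _ _ _ mUW.
pose UWp : {RV P >-> (T1 * T2)%type} := HB.pack (fun w => (U w, W w)) UWm.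
have -> : \int[P]_w f (U w, W w) = \int[distribution P UWp]_z f z.
  by rewrite ge0_integral_distribution.
have -> : \int[distribution P UWp]_z f z = \int[distribution P U \x distribution P W]_z f z.
  apply: eq_measure_integral => A mA _; apply/esym; apply: product_measure_unique => //.
rewrite fubini_tonelli2// ge0_integral_distribution//.
  by apply: measurable_fun_fubini_tonelli_G.
by move=> y; apply: integral_ge0.
Qed.

End fubini_independent.

(** * Real recursions *)

Section power_recursions.
Context {R : realType}.
Implicit Types (a b s x y : R) (n p q : nat).

Lemma powRDp x a b : 0 < x -> x `^ (a + b) = x `^ a * x `^ b.
Proof. by move=> x0; rewrite powRD// (gt_eqF x0) implybT. Qed.

Lemma powRXn x a n : 0 <= x -> (x `^ a) ^+ n = x `^ (a * n%:R).
Proof. by move=> x0; rewrite powRrM powR_mulrn// powR_ge0. Qed.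

(** By homogeneity only the ratio z = y/x matters, and then exp t >= 1 + t and ln z <= z - 1
    suffice. This stands in for differentiating a negative power of n. *)
Lemma powRN_tangent s x y : 0 < x -> 0 < y -> 0 <= s ->
  x `^ (- s) - s * x `^ (- s - 1) * (y - x) <= y `^ (- s).
Proof.
move=> x0 y0 s0.
have -> : y `^ (- s) = x `^ (- s) * (y / x) `^ (- s).
  by rewrite -powRM ?divr_ge0 ?ltW// mulrCA mulfV ?mulr1// gt_eqF.
rewrite powRDp// (powR_inv1 (ltW x0)).
have -> : x `^ (- s) - s * (x `^ (- s) * x^-1) * (y - x) =
    x `^ (- s) * (1 - s * (y / x - 1)) by field; rewrite gt_eqF.
rewrite ler_wpM2l ?powR_ge0//.
have yx0 : 0 < y / x by rewrite divr_gt0.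
rewrite /powR gt_eqF// (le_trans _ (expR_ge1Dx _))// lerD2l mulNr lerN2.
by rewrite ler_wpM2l// -[in leLHS](subrKC 1 (y / x)) le_ln1Dx//; lra.
Qed.

Lemma powRN_small s e : 0 < s -> 0 < e ->
  exists N, forall n, (N <= n)%N -> n.+1%:R `^ (- s) <= e.
Proof.
move=> s0 e0; pose x := e `^ (- s^-1).
have x0 : 0 <= x by exact: powR_ge0.
exists (Num.bound x) => n Nn.
have xn : x <= n.+1%:R.
  apply: ltW; apply: (lt_le_trans (archi_boundP x0)).
  by rewrite ler_nat (leq_trans Nn).
rewrite powRN invf_ple ?posrE ?powR_gt0//.
have -> : e^-1 = x `^ s.
  by rewrite /x -powRrM mulNr mulVf ?gt_eqF// powR_inv1// ltW.
by rewrite ge0_ler_powR ?nnegrE// ltW.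
Qed.

(** A discrete Gronwall argument: [v + 1] satisfies a purely multiplicative recursion whose factors
    have a convergent product because a > 1. *)
Lemma bounded_recursion a (D : R) (v : nat -> R) : 1 < a -> 0 <= D ->
  (forall n, 0 <= v n) ->
  (forall n, (1 <= n)%N ->
    v n.+1 <= (1 + D * n%:R `^ (- a)) * v n + D * n%:R `^ (- a)) ->
  exists2 K, 0 < K & forall n, (1 <= n)%N -> v n <= K.
Proof.
move=> a1 D0 v0 vS; pose s := a - 1; have s0 : 0 < s by rewrite /s; lra.
(* The tangent inequality at n+1 yields s (n+1)^-a; the factor 2^a replaces n+1 by n, as n+1 <=
   2n. *)
pose B := D * 2 `^ a / s.
have B0 : 0 <= B by rewrite /B divr_ge0 ?mulr_ge0 ?powR_ge0// ltW.
(* B (n^-s - (n+1)^-s) dominates D n^-a, so the product of the factors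
   1 + D n^-a telescopes. *)
have step n : (1 <= n)%N ->
    D * n%:R `^ (- a) <= B * (n%:R `^ (- s) - n.+1%:R `^ (- s)).
  move=> n1; have n0 : 0 < n%:R :> R by rewrite ltr0n.
  have := @powRN_tangent s n.+1%:R n%:R (ltr0Sn _ _) n0 (ltW s0).
  have -> : n%:R - n.+1%:R = -1 :> R by rewrite -natr1; ring.
  rewrite mulrN mulr1 opprK.
  have -> : - s - 1 = - a by rewrite /s; lra.
  move=> hs; have h2 : n%:R `^ (- a) <= 2 `^ a * n.+1%:R `^ (- a).
    rewrite !powRN -ler_pdivrMl ?powR_gt0// -invfM lef_pV2 ?posrE ?mulr_gt0 ?powR_gt0//.
    rewrite -powRM// ge0_ler_powR ?nnegrE ?mulr_ge0//; first by lra.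
    by rewrite -natrM ler_nat; lia.
  apply: (le_trans (ler_wpM2l D0 h2)).
  have -> : D * (2 `^ a * n.+1%:R `^ (- a)) = B * (s * n.+1%:R `^ (- a)).
    by rewrite /B; field; rewrite gt_eqF.
  by rewrite ler_wpM2l//; lra.
exists ((v 1%N + 1) * expR B); first by rewrite mulr_gt0 ?expR_gt0 ?ltr_wpDl.
suff H n : v n.+1 + 1 <= (v 1%N + 1) * expR (B * (1 - n.+1%:R `^ (- s))).
  case=> // n _; have h := H n.
  have : v n.+1 <= v n.+1 + 1 by lra.
  move=> /le_trans; apply; apply: (le_trans h).
  by rewrite ler_wpM2l ?addr_ge0// ler_expR -[leRHS]mulr1 ler_wpM2l// gerBl powR_ge0.
elim: n => [|n IH].
  by rewrite powR1 subrr mulr0 expR0 mulr1.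
have Dn := step n.+1 isT.
have D1 : 0 <= D * n.+1%:R `^ (- a) by rewrite mulr_ge0 ?powR_ge0.
apply: (@le_trans _ _ ((1 + D * n.+1%:R `^ (- a)) * (v n.+1 + 1))).
  by have := vS n.+1 isT; lra.
have -> : B * (1 - n.+2%:R `^ (- s)) = B * (n.+1%:R `^ (- s) - n.+2%:R `^ (- s))
    + B * (1 - n.+1%:R `^ (- s)) by ring.
rewrite expRD mulrCA; apply: ler_pM => //; [lra|by rewrite addr_ge0|].
by apply: le_trans (expR_ge1Dx _); lra.
Qed.

(** Induction against K n^-b. Passing from n to n+1 lowers this target by a relative amount at most
    b/n, which half of the contraction k n^-a covers for large n since a < 1; the other half covers
    the source once K >= 2C/k. *)
Lemma rate_recursion a b (k C : R) (v : nat -> R) n0 :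
  0 < a -> a < 1 -> 0 <= b -> 0 < k -> 0 <= C -> (forall n, 0 <= v n) ->
  (forall n, (n0 <= n)%N -> (1 <= n)%N ->
    v n.+1 <= (1 - k * n%:R `^ (- a)) * v n + C * n%:R `^ (- a - b)) ->
  exists2 K, 0 < K & forall n, (1 <= n)%N -> v n <= K * n%:R `^ (- b).
Proof.
move=> a0 a1 b0 k0 C0 v0 vS.
have [N1 N1P] := powRN_small a0 (divr_gt0 ltr01 k0).
have s0 : 0 < 1 - a by lra.
(* Dividing by b + 1 rather than b keeps the case b = 0 legitimate. *)
have e0 : 0 < k / 2 / (b + 1) by rewrite !divr_gt0//; lra.
have [N2 N2P] := powRN_small s0 e0.
pose N := (maxn n0 (maxn N1 N2)).+1.
(* The sum makes the bound hold outright for the indices up to N, before the asymptotic regime. *)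
pose K := 1 + 2 * C / k + \sum_(i < N.+1) v i * i%:R `^ b.
have sum0 : 0 <= \sum_(i < N.+1) v i * i%:R `^ b.
  by apply: sumr_ge0 => i _; rewrite mulr_ge0 ?powR_ge0.
have Ck : 0 <= 2 * C / k by rewrite divr_ge0 ?mulr_ge0// ltW.
have K0 : 0 < K by rewrite /K; lra.
exists K => // n n1; have [nN|Nn] := leqP n N.
  have n0' : 0 < n%:R :> R by rewrite ltr0n.
  rewrite powRN ler_pdivlMr ?powR_gt0//.
  have nN1 : (n < N.+1)%N by [].
  rewrite /K (bigD1 (Ordinal nN1))//=.
  have : 0 <= \sum_(i < N.+1 | i != Ordinal nN1) v i * i%:R `^ b.
    by apply: sumr_ge0 => i _; rewrite mulr_ge0 ?powR_ge0.
  lra.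
have base : v N <= K * N%:R `^ (- b).
  rewrite powRN ler_pdivlMr ?powR_gt0 ?ltr0n//.
  rewrite /K (bigD1 ord_max)//=.
  have : 0 <= \sum_(i < N.+1 | i != ord_max) v i * i%:R `^ b.
    by apply: sumr_ge0 => i _; rewrite mulr_ge0 ?powR_ge0.
  lra.
have {Nn} : (N <= n)%N by exact: ltnW.
elim: n {n1} => [|n IH]; first by rewrite leqn0.
rewrite leq_eqVlt => /predU1P[<-//|]; rewrite ltnS => Nn.
case: n => [//|n] in IH Nn *.
have Nn' : (maxn n0 (maxn N1 N2) <= n)%N by exact: Nn.
move: Nn'; rewrite !geq_max => /and3P[n0n N1n N2n].
have h1 := N1P n N1n; have h2 := N2P n N2n.
have x0 : 0 < n.+1%:R :> R by rewrite ltr0n.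
have := vS n.+1 (leq_trans n0n (leqnSn _)) isT.
set t := n.+1%:R `^ (- a) in h1 *.
have t0 : 0 <= t by exact: powR_ge0.
have kt : k * t <= 1 by rewrite mulrC -ler_pdivlMr.
move=> /le_trans; apply.
have {}IH := IH Nn.
have kt' : 0 <= 1 - k * t by lra.
have := ler_wpM2l kt' IH; set B := n.+1%:R `^ (- b) in IH * => IH'.
have B0 : 0 <= B by exact: powR_ge0.
have -> : n.+1%:R `^ (- a - b) = t * B by rewrite powRDp.
apply: (@le_trans _ _ (K * (B - b * (n.+1%:R^-1 * B)))); last first.
  rewrite ler_wpM2l ?(ltW K0)//.
  have := @powRN_tangent b n.+1%:R n.+2%:R x0 (ltr0Sn _ _) b0.
  have -> : n.+2%:R - n.+1%:R = 1 :> R by rewrite -(natr1 n.+1); ring.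
  rewrite powRDp// (powR_inv1 (ltW x0)) -/B mulr1.
  by rewrite [B * _]mulrC.
have h3 : b * n.+1%:R^-1 <= k / 2 * t.
  have -> : n.+1%:R^-1 = n.+1%:R `^ (- (1 - a)) * t :> R.
    by rewrite /t -powRDp// -[LHS](powR_inv1 (ltW x0)); congr (_ `^ _); lra.
  rewrite mulrA ler_wpM2r//.
  have := ler_wpM2l b0 h2 => /le_trans; apply.
  rewrite mulrCA ger_pMr; last by lra.
  by rewrite ler_pdivrMr; lra.
have KC : 2 * C <= K * k.
  rewrite -ler_pdivrMr//; rewrite /K; lra.
have tB : 0 <= t * B by exact: mulr_ge0.
have := ler_wpM2r tB KC.
have := ler_wpM2l (ltW K0) (ler_wpM2r B0 h3).
move: IH'; move: (n.+1%:R^-1) => i; lra.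
Qed.

End power_recursions.

(** * From one-step inequalities to rates for all moments *)

Section moment_rates.
Context {R : realType}.
Implicit Types (n p q : nat).

(** One truncation pass at radius n^be, with [V0], [V1], [Vq] the moments of index p, p+1 and p+1+q.
    A quarter of the contraction absorbs the lower moment, another quarter the term g^2 V1, and half
    remains for [rate_recursion] with exponent al + be. *)
Lemma moment_rate_step (al be cg k D K : R) p q (V0 V1 Vq : nat -> R) :
  0 <= be -> be < al -> al + be < 1 -> 0 < cg -> 0 < k -> 0 < D -> 0 <= K ->
  (forall n, 0 <= V1 n) ->
  (forall n (y : R), 0 < y -> V0 n <= y * V1 n + y ^- p) ->
  (forall n, (1 <= n)%N ->
    Vq n / (n%:R `^ be) ^+ (2 * q) <= K * n%:R `^ (- ((al - be) * p.+1%:R))) ->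
  (forall n, (1 <= n)%N -> let g := cg * n%:R `^ (- al) in
    V1 n.+1 <= V1 n
      - k * (g / n%:R `^ be) * (V1 n - Vq n / (n%:R `^ be) ^+ (2 * q))
      + D * (g ^+ 2 * V0 n + g ^+ 2 * V1 n + g ^+ (2 * p.+1))) ->
  exists2 K', 0 < K' &
    forall n, (1 <= n)%N -> V1 n <= K' * n%:R `^ (- ((al - be) * p.+1%:R)).
Proof.
move=> be0 beal albe1 cg0 k0 D0 K0 V10 Y Hq HS.
have al0 : 0 < al by lra.
have [N NP] := @powRN_small R (al - be) (k / (4 * D * cg)) ltac:(lra)
  ltac:(by rewrite divr_gt0// !mulr_gt0).
set b := (al - be) * p.+1%:R.
pose C1 := D * (4 * D / k) ^+ p * cg ^+ p.+2.
pose C2 := D * cg ^+ (2 * p.+1).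
have C10 : 0 <= C1.
  by apply: ltW; rewrite /C1 mulr_gt0 ?exprn_gt0// mulr_gt0// exprn_gt0// divr_gt0// mulr_gt0.
have C20 : 0 <= C2 by apply: ltW; rewrite /C2 mulr_gt0 ?exprn_gt0.
apply: (@rate_recursion _ (al + be) b (k * cg / 2) (k * cg * K + C1 + C2) V1 N.+1) => //.
- lra.
- by rewrite /b mulr_ge0//; lra.
- by rewrite divr_gt0// mulr_gt0.
- by rewrite !addr_ge0// mulr_ge0// ltW// mulr_gt0.
case=> // n Nn _; have {HS} := HS n.+1 isT; have {Hq} := Hq n.+1 isT.
have {NP} := NP n Nn; rewrite -/b.
set x : R := n.+1%:R; have x1 : 1 <= x by rewrite /x ler1n.
have x0 : 0 < x by lra.
set g := cg * _ => hN hq /= hS.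
have g0 : 0 < g by rewrite mulr_gt0 ?powR_gt0.
set B := x `^ be in hq hS *; have B0 : 0 < B by rewrite powR_gt0.
(* Chosen so that D g^2 y = (k/4) (g/B). The Young residue D g^2 y^-p is then of order g^(p+2) B^p,
   that is n^-(al+be) n^-b, which is the origin of the rate b = (al - be)(p+1). *)
pose y := k / (4 * D * g * B).
have y0 : 0 < y by rewrite divr_gt0// mulr_gt0// mulr_gt0// mulr_gt0.
have := Y n.+1 y y0.
have gB : g / B = cg * x `^ (- (al + be)).
  by rewrite /g /B -mulrA -powRN -powRDp// opprD.
have e1 : D * g ^+ 2 * y = k / 4 * (g / B).
  by rewrite /y; field; rewrite !gt_eqF.
have e2 : D * g ^+ 2 * y ^- p = C1 * x `^ (- (al + be) - b).
  have -> : y ^- p = (4 * D / k) ^+ p * (g ^+ p * B ^+ p).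
    by rewrite -exprVn /y -!exprMn; congr (_ ^+ p); field; rewrite !gt_eqF.
  have -> : D * g ^+ 2 * ((4 * D / k) ^+ p * (g ^+ p * B ^+ p)) =
     D * (4 * D / k) ^+ p * (g ^+ p.+2 * B ^+ p) by rewrite -[p.+2]addn2 exprD; ring.
  have -> : g ^+ p.+2 * B ^+ p = cg ^+ p.+2 * x `^ (- (al + be) - b).
    rewrite /g exprMn -mulrA; congr (_ * _).
    rewrite /B !powRXn ?(ltW x0)// -powRDp//; congr (_ `^ _).
    by rewrite /b -(natr1 p.+1) -(natr1 p); ring.
  by rewrite /C1 mulrA.
have e3 : D * g ^+ (2 * p.+1) <= C2 * x `^ (- (al + be) - b).
  rewrite /g exprMn /C2 -!mulrA; apply: ler_wpM2l; first exact: ltW.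
  apply: ler_wpM2l; first by apply: ltW; rewrite exprn_gt0.
  rewrite powRXn ?(ltW x0)// ler_powR//.
  rewrite natrM /b -(natr1 p); have : 0 <= p%:R :> R by [].
  move: (p%:R) => P P0; have : 0 <= al * P by rewrite mulr_ge0// ltW.
  have : 0 <= be * P by rewrite mulr_ge0.
  lra.
have e4 : D * g ^+ 2 <= k / 4 * (g / B).
  have -> : k / 4 * (g / B) = D * g * (cg * (k / (4 * D * cg)) / B).
    by field; rewrite !gt_eqF.
  rewrite expr2 mulrA; apply: ler_wpM2l; first by apply: ltW; rewrite mulr_gt0.
  rewrite /g -mulrA; apply: ler_wpM2l; first exact: ltW.
  rewrite ler_pdivlMr// /B -powRDp//.
  by move: hN; congr (_ `^ _ <= _); ring.
move=> hY.
have h1 := ler_wpM2l (ltW (mulr_gt0 D0 (exprn_gt0 2 g0))) hY.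
have h2 := ler_wpM2r (V10 n.+1) e4.
have gB0 : 0 <= g / B by apply: ltW; rewrite divr_gt0.
have h3 := ler_wpM2l (mulr_ge0 (ltW k0) gB0) hq.
move: h1; rewrite mulrDr [_ * (y * _)]mulrA e1 e2 => h1.
have h4 : k * (g / B) * (K * x `^ (- b)) = k * cg * K * x `^ (- (al + be) - b).
  by rewrite gB powRDp//; ring.
have h5 : k * (g / B) = k * cg * x `^ (- (al + be)) by rewrite gB mulrA.
rewrite h4 in h3.
apply: (le_trans hS).
have -> : (1 - k * cg / 2 * x `^ (- (al + be))) * V1 n.+1 =
  V1 n.+1 - k * (g / B) / 2 * V1 n.+1 by rewrite h5; field.
move: (V1 n.+1) (V0 n.+1) (Vq n.+1 / _) (x `^ (- (al + be) - b)) (g / B) h1 h2 h3 e3.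
move=> v1 v0 vq z gb; lra.
Qed.

(** [U p n] stands for the moment of order 2p of the n-th error. The last hypothesis leaves the
    radius A and the extra order q free, so both passes draw on the same inequality. *)
Lemma moment_rates (al cg : R) (U : nat -> nat -> R) :
  2^-1 < al -> al < 1 -> 0 < cg ->
  (forall p n, 0 <= U p n) -> (forall n, U 0 n <= 1) ->
  (forall p n (y : R), 0 < y -> U p n <= y * U p.+1 n + y ^- p) ->
  (forall p, exists2 D, 0 < D & forall n, (1 <= n)%N ->
    let g := cg * n%:R `^ (- al) in
    U p.+1 n.+1 <= U p.+1 n
      + D * (g ^+ 2 * U p n + g ^+ 2 * U p.+1 n + g ^+ (2 * p.+1))) ->
  (forall p, exists k D, [/\ 0 < k, 0 < D & forall n (A : R) q, (1 <= n)%N -> 1 <= A ->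
    let g := cg * n%:R `^ (- al) in
    U p.+1 n.+1 <= U p.+1 n
      - k * (g / A) * (U p.+1 n - U (p.+1 + q)%N n / A ^+ (2 * q))
      + D * (g ^+ 2 * U p n + g ^+ 2 * U p.+1 n + g ^+ (2 * p.+1))]) ->
  forall p, exists2 K, 0 < K &
    forall n, (1 <= n)%N -> U p n <= K * n%:R `^ (- (al * p%:R)).
Proof.
move=> al2 al1 cg0 U0 U01 Y S0 S.
have bnd p : exists2 K, 0 < K & forall n, (1 <= n)%N -> U p n <= K.
  elim: p => [|p [K K0 KP]]; first by exists 1.
  have [D D0 DP] := S0 p.
  (* Boundedness goes by induction on the order: the bound K on moment p enters the recursion for
     moment p+1 as a source. All sources are at most n^(-2 al), and 2 al > 1. *)
  pose D' := D * cg ^+ 2 * K + D * cg ^+ 2 + D * cg ^+ (2 * p.+1).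
  have a1 : 1 < 2 * al by lra.
  have t2 : 0 <= D * cg ^+ 2 by apply: ltW; rewrite mulr_gt0 ?exprn_gt0.
  have t1 : 0 <= D * cg ^+ 2 * K by rewrite mulr_ge0// ltW.
  have t3 : 0 <= D * cg ^+ (2 * p.+1) by apply: ltW; rewrite mulr_gt0 ?exprn_gt0.
  have D'0 : 0 <= D' by rewrite /D' !addr_ge0.
  apply: (@bounded_recursion _ (2 * al) D' (U p.+1)) => //.
  move=> n n1; have := DP n n1; have := KP n n1; have := U0 p n; have := U0 p.+1 n.
  have x0 : 0 < n%:R :> R by rewrite ltr0n.
  have x1 : 1 <= n%:R :> R by rewrite ler1n.
  rewrite /= !exprMn !powRXn ?(ltW x0)// (mulrC (- al) 2) mulrN.
  set z := n%:R `^ _; set w := n%:R `^ _.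
  have z0 : 0 <= z by exact: powR_ge0.
  have wz : w <= z.
    rewrite /w /z ler_powR// -(mulr1 (2 * al)) natrM mulrA -mulNr.
    rewrite [- al * 2]mulNr [al * 2]mulrC !mulNr lerN2 ler_wpM2l ?ler1n//; lra.
  move=> u1 u2 u3 u4; apply: (le_trans u4).
  have h1 := ler_wpM2l (mulr_ge0 t2 z0) u3.
  have h2 := ler_wpM2l t3 wz.
  have h3 : 0 <= (D * cg ^+ 2 * K) * z * U p.+1 n by rewrite mulr_ge0// mulr_ge0.
  have h4 : 0 <= (D * cg ^+ (2 * p.+1)) * z * U p.+1 n by rewrite mulr_ge0// mulr_ge0.
  have h5 : 0 <= D * cg ^+ 2 * z by rewrite mulr_ge0.
  rewrite /D'; lra.
have [be [be0 beal albe]] : exists be : R, [/\ 0 < be, be < al & al + be < 1].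
  by exists ((1 - al) / 2); split; lra.
have c0 : 0 < al - be by lra.
have al0 : 0 < al by lra.
have crude p : exists2 K, 0 < K & forall n, (1 <= n)%N ->
    U p n <= K * n%:R `^ (- ((al - be) * p%:R)).
  case: p => [|p].
    by exists 1 => // n _; rewrite mulr0 oppr0 powRr0 mulr1.
  have [k [D [k0 D0 SP]]] := S p.
  (* Large enough that n^(-2 be q) alone brings the bounded tail moment below the target rate. *)
  pose q := Num.bound ((al - be) * p.+1%:R / (2 * be)).
  have [K K0 KP] := bnd (p.+1 + q)%N.
  apply: (@moment_rate_step al be cg k D K p q (U p) (U p.+1) (U (p.+1 + q)%N)) => //.
  - exact: ltW.
  - exact: ltW.
  - by move=> n y; exact: Y.
  - move=> n n1; have x1 : 1 <= n%:R :> R by rewrite ler1n.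
    have x0 : 0 < n%:R :> R by rewrite ltr0n.
    apply: ler_pM; rewrite ?invr_ge0 ?exprn_ge0 ?powR_ge0//; first exact: KP.
    rewrite powRXn ?(ltW x0)// -powRN ler_powR// lerN2 natrM mulrA [be * 2]mulrC.
    have b2 : 0 < 2 * be by lra.
    have h0 : 0 <= (al - be) * p.+1%:R / (2 * be) by rewrite divr_ge0 ?mulr_ge0 ?ltW.
    have := archi_boundP h0; rewrite -/q ltr_pdivrMr// => /ltW.
    by rewrite [leRHS]mulrC.
  - move=> n n1 /=; apply: SP => //.
    by rewrite -[leLHS](powRr0 n%:R) ler_powR ?ler1n// ltW.
move=> p; case: p => [|p].
  by exists 1 => // n _; rewrite mulr0 oppr0 powRr0 mulr1.
have [k [D [k0 D0 SP]]] := S p.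
(* Now the radius is 1 and the tail must be small by itself: its crude exponent (al - be)(p+1+q) is
   at least al (p+1). *)
pose q := Num.bound (al * p.+1%:R / (al - be)).
have [K K0 KP] := crude (p.+1 + q)%N.
have := @moment_rate_step al 0 cg k D K p q (U p) (U p.+1) (U (p.+1 + q)%N).
rewrite subr0 addr0; apply => //.
- exact: ltW.
- by move=> n y; exact: Y.
- move=> n n1; have x1 : 1 <= n%:R :> R by rewrite ler1n.
  rewrite powRr0 expr1n divr1; apply: (le_trans (KP n n1)).
  rewrite ler_wpM2l ?(ltW K0)// ler_powR// lerN2.
  have h0 : 0 <= al * p.+1%:R / (al - be) by rewrite divr_ge0 ?mulr_ge0// ltW.
  have := archi_boundP h0; rewrite -/q ltr_pdivrMr// => /ltW h; apply: (le_trans h).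
  by rewrite mulrC ler_wpM2l ?(ltW c0)// ler_nat leq_addl.
- by move=> n n1; apply: SP => //; rewrite powRr0.
Qed.

End moment_rates.

(** * Expectations *)

Section real_expectation.
Context {d : measure_display} {Omega : measurableType d} {R : realType}
  (P : probability Omega R).
Implicit Types f g : Omega -> R.

Definition integrableR f := P.-integrable setT (EFin \o f).

(** A real-valued integral, convenient for arithmetic but meaningful only for integrable f;
    integrability therefore accompanies each bound. *)
Definition Ex f : R := (\int[P]_w f w)%R.

Lemma Ex_EFin f : integrableR f -> (\int[P]_w (f w)%:E = (Ex f)%:E)%E.
Proof. by move=> fi; rewrite /Ex /Rintegral fineK//; exact: integrable_fin_num. Qed.

Lemma integrableR_le f g : measurable_fun setT f -> (forall w, `|f w| <= g w) ->
  integrableR g -> integrableR f.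
Proof.
move=> mf fg; apply: le_integrable => //; first exact/measurable_EFinP.
by move=> w _; rewrite /= lee_fin (le_trans (fg w))// ler_norm.
Qed.

Lemma integrableR_cst (k : R) : integrableR (fun=> k).
Proof. exact: finite_measure_integrable_cst. Qed.

Lemma integrableRD f g : integrableR f -> integrableR g ->
  integrableR (fun w => f w + g w).
Proof. by move=> fi gi; have := integrableD measurableT fi gi. Qed.

Lemma integrableRZ (k : R) f : integrableR f -> integrableR (fun w => k * f w).
Proof. by move=> fi; have := integrableZl measurableT k fi. Qed.

Lemma ExD f g : integrableR f -> integrableR g ->
  Ex (fun w => f w + g w) = Ex f + Ex g.
Proof. by move=> fi gi; rewrite /Ex RintegralD. Qed.

Lemma ExZ (k : R) f : integrableR f -> Ex (fun w => k * f w) = k * Ex f.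
Proof. by move=> fi; rewrite /Ex RintegralZl. Qed.

Lemma Ex_cst (k : R) : Ex (fun=> k) = k.
Proof. by rewrite /Ex Rintegral_cst// [X in fine X]probability_setT mulr1. Qed.

Lemma Ex_le f g : integrableR f -> integrableR g -> (forall w, f w <= g w) ->
  Ex f <= Ex g.
Proof. by move=> fi gi fg; apply: le_Rintegral => // w _. Qed.

Lemma Ex_ge0 f : (forall w, 0 <= f w) -> 0 <= Ex f.
Proof. by move=> f0; apply: Rintegral_ge0 => w _. Qed.

Lemma integrableR_of_le f (B : R) : measurable_fun setT f -> (forall w, 0 <= f w) ->
  (\int[P]_w (f w)%:E <= B%:E)%E -> integrableR f /\ Ex f <= B.
Proof.
move=> mf f0 fB.
have fi : integrableR f.
  apply/integrableP; split; first exact/measurable_EFinP.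
  under eq_integral => w _ do rewrite /= ger0_norm//.
  exact: le_lt_trans fB (ltry _).
by split => //; rewrite -lee_fin -Ex_EFin.
Qed.

Lemma expectationE f : 'E_P[f]%E = (\int[P]_w (f w)%:E)%E.
Proof. by rewrite unlock. Qed.

Lemma integrableR_Ex_sum (I : eqType) (s : seq I) (f : I -> Omega -> R) :
  (forall i, i \in s -> integrableR (f i)) ->
  integrableR (fun w => \sum_(i <- s) f i w) /\
  Ex (fun w => \sum_(i <- s) f i w) = \sum_(i <- s) Ex (f i).
Proof.
elim: s => [|i s IH] fi.
  rewrite big_nil (_ : (fun w => _) = fun=> 0).
    by split; [exact: integrableR_cst|rewrite Ex_cst].
  by apply/funext => w; rewrite big_nil.
have fii : integrableR (f i) by apply: fi; rewrite inE eqxx.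
have [|is_ Es] := IH; first by move=> j js; apply: fi; rewrite inE js orbT.
rewrite (_ : (fun w => _) = fun w => f i w + \sum_(j <- s) f j w).
  by split; [exact: integrableRD|rewrite big_cons -Es ExD].
by apply/funext => w; rewrite big_cons.
Qed.

Lemma integrableR_pow_le f p q : (p <= q)%N -> (forall w, 0 <= f w) ->
  measurable_fun setT f -> integrableR (fun w => f w ^+ q) ->
  integrableR (fun w => f w ^+ p).
Proof.
move=> pq f0 mf fq; apply: (@integrableR_le _ (fun w => 1 + f w ^+ q)).
- exact: measurable_funX.
- move=> w; rewrite ger0_norm ?exprn_ge0//.
  have [f1|f1] := leP (f w) 1.
    by rewrite (le_trans (exprn_ile1 _ (f0 w) f1))// lerDl exprn_ge0.
  by rewrite (le_trans (ler_weXn2l (ltW f1) pq))// lerDr.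
- by apply: integrableRD => //; exact: integrableR_cst.
Qed.

End real_expectation.

(** * One-step expectations and integration over the next observation *)

Section conditional_step.
Context {R : realType} {H : completeNormedModType R} (dot : {dot H for idfun}).
Context (dotE : hilbert_dot dot) (Hsep : separable H).
Context {d : measure_display} {Omega : measurableType d} (P : probability Omega R).

Lemma expect_pow_norm_sub_le p : exists2 C : R, 0 < C &
  forall (Y : Omega -> borel H) (a v : H) (B Bp : R),
    measurable_fun setT Y ->
    (\int[P]_w (dot (Y w) a)%:E = (dot v a)%:E)%E ->
    (\int[P]_w (`|Y w : H| ^+ 2)%:E <= B%:E)%E ->
    (\int[P]_w (`|Y w : H| ^+ (2 * p.+1))%:E <= Bp%:E)%E ->
    (\int[P]_w (`|a - (Y w : H)| ^+ (2 * p.+1))%:E <=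
      (`|a| ^+ (2 * p.+1) - 2 * p.+1%:R * `|a| ^+ (2 * p) * dot v a
       + C * (`|a| ^+ (2 * p) * B + Bp))%:E)%E.
Proof.
have [C C0 HC] := pow_norm_sub_le dotE p; exists C => // Y a v B Bp mY Ymean YB YBp.
have mn : measurable_fun setT (fun w => `|Y w : H|) by exact: borel_measurable_norm.
have [i2 E2] : integrableR P (fun w => `|Y w : H| ^+ 2) /\ Ex P (fun w => `|Y w : H| ^+ 2) <= B.
  by apply: integrableR_of_le => //; exact: measurable_funX.
have [ip Ep] : integrableR P (fun w => `|Y w : H| ^+ (2 * p.+1)) /\
    Ex P (fun w => `|Y w : H| ^+ (2 * p.+1)) <= Bp.
  by apply: integrableR_of_le => //; exact: measurable_funX.
have i1 : integrableR P (fun w => `|Y w : H|).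
  have := @integrableR_pow_le _ _ _ P (fun w => `|Y w : H|) 1 2.
  by move=> /(_ _ _ mn i2); apply.
have id : integrableR P (fun w => dot (Y w) a).
  apply: (@integrableR_le _ _ _ _ _ (fun w => `|a| * `|Y w : H|)).
  - by apply: borel_measurable_dot => //; exact: measurable_cst.
  - by move=> w; rewrite mulrC; exact: dot_cauchy_schwarz.
  - exact: integrableRZ.
have Ed : Ex P (fun w => dot (Y w) a) = dot v a.
  by apply: EFin_inj; rewrite -Ex_EFin.
set K1 := `|a| ^+ (2 * p.+1); set K2 := 2 * p.+1%:R * `|a| ^+ (2 * p).
set K3 := `|a| ^+ (2 * p).
have irhs : integrableR P (fun w => (K1 + (- K2) * dot (Y w) a) +
    (C * K3 * `|Y w : H| ^+ 2 + C * `|Y w : H| ^+ (2 * p.+1))).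
  apply: integrableRD; apply: integrableRD; do ?apply: integrableRZ => //.
  exact: integrableR_cst.
have le w : `|a - (Y w : H)| ^+ (2 * p.+1) <= (K1 + (- K2) * dot (Y w) a) +
    (C * K3 * `|Y w : H| ^+ 2 + C * `|Y w : H| ^+ (2 * p.+1)).
  by apply: (le_trans (HC a (Y w))); rewrite -/K1 -/K2 -/K3; lra.
have ilhs : integrableR P (fun w => `|a - (Y w : H)| ^+ (2 * p.+1)).
  apply: integrableR_le irhs => [|w]; last by rewrite ger0_norm ?exprn_ge0.
  apply: measurable_funX; apply: borel_measurable_norm => //.
  by apply: borel_measurable_sub => //; exact: measurable_cst.
rewrite Ex_EFin// lee_fin (le_trans (Ex_le ilhs irhs le))//.
have iK : integrableR P (fun w => K1 + (- K2) * dot (Y w) a).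
  by apply: integrableRD; [exact: integrableR_cst|exact: integrableRZ].
have iC : integrableR P (fun w => C * K3 * `|Y w : H| ^+ 2 + C * `|Y w : H| ^+ (2 * p.+1)).
  by apply: integrableRD; exact: integrableRZ.
rewrite ExD// ExD//; [|exact: integrableR_cst|exact: integrableRZ].
rewrite ExD//; [|exact: integrableRZ|exact: integrableRZ].
rewrite Ex_cst !ExZ// Ed mulNr lerD2l mulrDr mulrA.
have CK : 0 <= C * K3 by rewrite mulr_ge0 ?exprn_ge0// ltW.
by apply: lerD; [exact: ler_wpM2l|apply: ler_wpM2l => //; exact: ltW].
Qed.

Context {d' : measure_display} {XX : measurableType d'}.
Context (X : {RV P >-> XX}) (Xs : nat -> {RV P >-> XX}).
Context (Xs_indep : mutually_independent P [set n | (1 <= n)%N]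
  (fun n => Xs n : Omega -> XX)).
Context (Xs_law : forall n, (1 <= n)%N -> same_law (Xs n) X).

(** The natural filtration at n as a measurable type on Omega, so that adaptedness is plain
    measurability of a map out of [past n]. *)
Definition past n := g_sigma_algebraType
  (\bigcup_(k in [set k | (1 <= k <= n)%N])
     preimage_set_system setT (Xs k : Omega -> XX) measurable).

Lemma past_measurable {e} {Y : measurableType e} n (W : Omega -> Y) :
  measurable_fun setT (W : past n -> Y) -> measurable_fun setT W.
Proof.
move=> mW _ B mB; apply: (@natural_filtration_measurable _ _ _ _ _ P Xs n).
exact: mW.
Qed.

Lemma past_le {e} {Y : measurableType e} m n (W : Omega -> Y) : (m <= n)%N ->
  measurable_fun setT (W : past m -> Y) -> measurable_fun setT (W : past n -> Y).
Proof.
move=> mn mW _ B mB; have := mW measurableT B mB.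
apply: smallest_sub; first exact: smallest_sigma_algebra.
move=> A [k /= /andP[k1 km] h]; apply: sub_sigma_algebra.
by exists k => //=; rewrite k1 (leq_trans km).
Qed.

Lemma past_observation k n : (1 <= k <= n)%N ->
  measurable_fun setT (Xs k : past n -> XX).
Proof.
by move=> kn _ B mB; apply: sub_sigma_algebra; exists k => //; exists B.
Qed.

(* The conditional expectation given the past is computed by freezing the
   past-measurable argument W, as the next observation is independent of it. *)
Lemma next_observation_le {e} {Y : measurableType e} n (W : Omega -> Y)
    (phi : XX * Y -> R) (psi : Y -> R) :
  measurable_fun setT (W : past n -> Y) ->
  measurable_fun setT phi -> (forall z, 0 <= phi z) ->
  (forall y, (\int[P]_w (phi (X w, y))%:E <= (psi y)%:E)%E) ->
  integrableR P (psi \o W) ->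
  integrableR P (fun w => phi (Xs n.+1 w, W w)) /\
  Ex P (fun w => phi (Xs n.+1 w, W w)) <= Ex P (psi \o W).
Proof.
move=> mW mphi phi0 phipsi ipsi.
have mW' := past_measurable mW.
pose Wm := isMeasurableFun.Build _ _ _ _ _ mW'.
pose Wp : {RV P >-> Y} := HB.pack W Wm.
have mphiW : measurable_fun setT (fun w => phi (Xs n.+1 w, W w)).
  apply: (measurableT_comp mphi); apply: measurable_fun_pair => //.
have mephi : measurable_fun setT (EFin \o phi) by exact/measurable_EFinP.
have -> : Ex P (psi \o W) = fine (\int[P]_w (psi (W w))%:E)%E by [].
apply: integrableR_of_le => //.
have -> : (\int[P]_w (phi (Xs n.+1 w, W w))%:E)%E =
    (\int[P]_w \int[distribution P (Xs n.+1)]_x (phi (x, W w))%:E)%E.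
  apply: (@integral_indep _ _ _ _ _ _ _ P (Xs n.+1) Wp (EFin \o phi)) => //.
    move=> A B mA mB; rewrite setIC muleC; apply: indep_natural_filtration => //.
    by have := mW measurableT B mB; rewrite setTI.
rewrite fineK; last exact: integrable_fin_num.
have law y : (\int[distribution P (Xs n.+1)]_x (phi (x, y))%:E <= (psi y)%:E)%E.
  rewrite (eq_measure_integral (distribution P X)) => [|A mA _]; last exact: Xs_law.
  rewrite ge0_integral_distribution//.
  - exact: phipsi.
  - exact: (measurable_fun_pair1 y mephi).
  - by move=> x; rewrite lee_fin.
apply: ge0_le_integral => //.
- by move=> w _; apply: integral_ge0 => x _; rewrite lee_fin.
- have mG : measurable_fun setT
      (fun y => \int[distribution P (Xs n.+1)]_x (phi (x, y))%:E)%E.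
    apply: (@measurable_fun_fubini_tonelli_G _ _ _ _ _ (distribution P (Xs n.+1))
      (EFin \o phi) mephi).
    by move=> z; rewrite lee_fin.
  exact: (measurableT_comp mG mW').
- exact: measurable_int ipsi.
Qed.

End conditional_step.

(** * Weighted sums and summation by parts *)

Section averaging.
Context {R : realType}.

Lemma sum_inv_sqrt_le n :
  \sum_(1 <= k < n.+1) k%:R `^ (- 2^-1) <= 2 * n%:R `^ 2^-1 :> R.
Proof.
elim: n => [|n IH]; first by rewrite big_geq// mulr_ge0// powR_ge0.
rewrite big_nat_recr//=; apply: (le_trans (lerD IH (lexx _))).
rewrite powRN; set x : R := n.+1%:R `^ 2^-1; set y : R := n%:R `^ 2^-1.
have x0 : 0 < x by rewrite powR_gt0.
have x2 : x ^+ 2 = n%:R + 1 by rewrite /x powRXn// mulVf// powRr1// natr1.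
have y2 : y ^+ 2 = n%:R by rewrite /y powRXn// mulVf// powRr1.
rewrite -(ler_pM2l x0) mulrDr mulfV ?gt_eqF//.
have := sqr_ge0 (x - y); rewrite sqrrB x2 y2; move: x2; rewrite expr2 => x2.
have -> : x * (2 * x) = 2 * (n%:R + 1) by rewrite -x2; ring.
lra.
Qed.

(** The ratio z = n/(n+1) lies in (0, 1], so z^a >= z when a <= 1. *)
Lemma powR_increment_le (a : R) n : 0 <= a -> a <= 1 -> (1 <= n)%N ->
  0 <= n.+1%:R `^ a - n%:R `^ a <= n.+1%:R `^ (a - 1).
Proof.
move=> a0 a1 n1; have x0 : 0 < n.+1%:R :> R by rewrite ltr0n.
have y0 : 0 < n%:R :> R by rewrite ltr0n.
have yx : n%:R <= n.+1%:R :> R by rewrite ler_nat.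
apply/andP; split; first by rewrite subr_ge0 ge0_ler_powR ?nnegrE.
have -> : n%:R `^ a = n.+1%:R `^ a * (n%:R / n.+1%:R) `^ a :> R.
  by rewrite -powRM ?divr_ge0// mulrCA mulfV ?mulr1// gt_eqF.
rewrite powRDp// powR_inv1// lerBlDr -mulrDr -[leLHS]mulr1.
rewrite ler_wpM2l ?powR_ge0//.
rewrite [leLHS](_ : _ = n.+1%:R^-1 + n%:R / n.+1%:R :> R); last first.
  by rewrite -[X in X + _]mul1r -mulrDl nat1r mulfV// gt_eqF.
rewrite lerD2l ger1_powR// divr_gt0//= ler_pdivrMr// mul1r//.
Qed.

Lemma summation_by_parts_le (V : normedModType R) (D : nat -> V) (gi : nat -> R)
    (cg a : R) n :
  0 < cg -> 0 <= a -> a <= 1 ->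
  (forall k, (1 <= k)%N -> gi k = (cg * k%:R `^ (- a))^-1) ->
  `|\sum_(1 <= k < n.+2) gi k *: (D k - D k.+1)| <=
  gi n.+1 * `|D n.+2| + \sum_(1 <= k < n.+2) cg^-1 * k%:R `^ (a - 1) * `|D k|.
Proof.
move=> cg0 a0 a1 giP.
have giE k : gi k.+1 = cg^-1 * k.+1%:R `^ a by rewrite giP// powRN invfM invrK.
have gi0 k : 0 <= gi k.+1 by rewrite giE mulr_ge0 ?powR_ge0// invr_ge0 ltW.
(* With the boundary term put back, the sum grows at each step by exactly the increment of [gi]
   times [D], which suits induction. *)
suff h : `|\sum_(1 <= k < n.+2) gi k *: (D k - D k.+1) + gi n.+1 *: D n.+2| <=
    \sum_(1 <= k < n.+2) cg^-1 * k%:R `^ (a - 1) * `|D k|.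
  rewrite -[X in `|X|](addrK (gi n.+1 *: D n.+2)).
  apply: (le_trans (ler_normB _ _)); rewrite addrC normrZ (ger0_norm (gi0 _)).
  by rewrite lerD2l.
elim: n => [|n IH].
  by rewrite !big_nat1 scalerBr subrK normrZ (ger0_norm (gi0 _)) giE !powR1.
rewrite big_nat_recr//= [leRHS]big_nat_recr//=.
have -> : \sum_(1 <= k < n.+2) gi k *: (D k - D k.+1) +
     gi n.+2 *: (D n.+2 - D n.+3) + gi n.+2 *: D n.+3 =
   (\sum_(1 <= k < n.+2) gi k *: (D k - D k.+1) + gi n.+1 *: D n.+2)
   + (gi n.+2 - gi n.+1) *: D n.+2.
  rewrite -[LHS]addrA scalerBr subrK -[RHS]addrA; congr (_ + _).
  by rewrite scalerBl addrC subrK.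
apply: (le_trans (ler_normD _ _)); apply: lerD => //.
rewrite normrZ; apply: ler_wpM2r => //.
have /andP[h1 h2] := @powR_increment_le a n.+1 a0 a1 isT.
rewrite !giE -mulrBr ger0_norm; last by rewrite mulr_ge0// invr_ge0 ltW.
by rewrite ler_wpM2l// invr_ge0 ltW.
Qed.

Context {d : measure_display} {Omega : measurableType d} (P : probability Omega R).

(** Jensen with weights k^(-1/2) leaves the moments of k^(1/2) times each summand. These are
    bounded: the A part has order k^((al-1)p) and the B part k^((1-2al)p). The total weight, at most
    2 n^(1/2), raised to 2p gives n^p. A dominating F is all that is asked of the sum. *)
Lemma weighted_sum_moment (r : nat -> Omega -> R) (al A B : R) p :
  2^-1 <= al -> al <= 1 -> 0 < A -> 0 < B -> (0 < p)%N ->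
  (forall k w, 0 <= r k w) ->
  (forall q, exists2 K, 0 < K & forall k, (1 <= k)%N ->
    integrableR P (fun w => r k w ^+ (2 * q)) /\
    Ex P (fun w => r k w ^+ (2 * q)) <= K * k%:R `^ (- (al * q%:R))) ->
  exists2 K, 0 < K & forall n, exists F : Omega -> R,
    [/\ integrableR P F,
        forall w, (\sum_(1 <= k < n.+1)
          (A * k%:R `^ (al - 1) * r k w + B * r k w ^+ 2)) ^+ (2 * p) <= F w
      & Ex P F <= K * n%:R ^+ p].
Proof.
move=> al2 al1 A0 B0 p0 r0 mom.
have [K1 K10 HK1] := mom p; have [K2 K20 HK2] := mom (2 * p)%N.
pose s := (2 * p)%N.
have [q sq] : exists q, s = q.+1 by exists s.-1; rewrite prednK// muln_gt0.
have two0 : 0 < 2 ^+ s :> R by rewrite exprn_gt0.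
have As0 : 0 < A ^+ s by rewrite exprn_gt0.
have Bs0 : 0 < B ^+ s by rewrite exprn_gt0.
pose K0 := 2 ^+ s * (A ^+ s * K1 + B ^+ s * K2).
have K00 : 0 < K0 by rewrite mulr_gt0// addr_gt0// mulr_gt0.
exists (2 ^+ s * K0); first by rewrite mulr_gt0.
move=> n.
pose v k : R := k%:R `^ (- 2^-1); have v0 k : 0 <= v k by exact: powR_ge0.
(* [c1] and [c2] are the coefficients left after splitting the power s = 2p of k^(1/2) times the
   k-th summand by [powD_le]. *)
pose c1 k : R := 2 ^+ s * (A ^+ s * k%:R `^ ((2 * al - 1) * p%:R)).
pose c2 k : R := 2 ^+ s * (B ^+ s * k%:R ^+ p).
pose W := \sum_(1 <= k < n.+1) v k.
have W0 : 0 <= W by apply: sumr_ge0.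
pose f k w := v k * (c1 k * r k w ^+ s + c2 k * r k w ^+ (2 * s)).
have fint k : (1 <= k)%N -> integrableR P (f k) /\ Ex P (f k) <= v k * K0.
  move=> k1; have [i1 e1] := HK1 k k1; have [i2 e2] := HK2 k k1.
  have j1 := integrableRZ (c1 k) i1; have j2 := integrableRZ (c2 k) i2.
  have j := integrableRD j1 j2; split; first exact: integrableRZ.
  rewrite [X in X <= _](ExZ _ j) ler_wpM2l// (ExD j1 j2) (ExZ _ i1) (ExZ _ i2).
  have x1 : 1 <= k%:R :> R by rewrite ler1n.
  have x0 : 0 < k%:R :> R by rewrite ltr0n.
  have P0 : 0 <= p%:R :> R by [].
  rewrite /K0 mulrDr; apply: lerD.
    rewrite /c1 -mulrA; apply: ler_wpM2l; first exact: ltW.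
    rewrite -mulrA; apply: ler_wpM2l; first exact: ltW.
    apply: (le_trans (ler_wpM2l (powR_ge0 _ _) e1)).
    rewrite mulrCA -powRDp// ger_pMr// -[leRHS](powRr0 k%:R) ler_powR//.
    have : (al - 1) * p%:R <= 0 by rewrite mulr_le0_ge0//; lra.
    lra.
  rewrite /c2 -mulrA; apply: ler_wpM2l; first exact: ltW.
  rewrite -mulrA; apply: ler_wpM2l; first exact: ltW.
  apply: (le_trans (ler_wpM2l (exprn_ge0 _ (ltW x0)) e2)).
  rewrite mulrCA -(powR_mulrn p (ltW x0)) -powRDp// ger_pMr// -[leRHS](powRr0 k%:R) ler_powR//.
  rewrite natrM; have : 0 <= (al - 2^-1) * p%:R by rewrite mulr_ge0//; lra.
  lra.
pose s' := index_iota 1 n.+1.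
have mem k : k \in s' -> (1 <= k)%N by rewrite mem_index_iota => /andP[].
have [sumi sumE] := @integrableR_Ex_sum _ _ _ P _ s' f (fun k ks => (fint k (mem k ks)).1).
exists (fun w => W ^+ q * \sum_(k <- s') f k w); split.
- exact: integrableRZ.
- move=> w; set Y := fun k => A * k%:R `^ (al - 1) * r k w + B * r k w ^+ 2.
  have Y0 k : 0 <= Y k.
    by rewrite /Y addr_ge0// ?mulr_ge0 ?powR_ge0 ?sqr_ge0// ltW.
  have -> : \sum_(1 <= k < n.+1) Y k = \sum_(1 <= k < n.+1) v k * (k%:R `^ 2^-1 * Y k).
    rewrite !big_seq; apply: eq_bigr => k /mem k1.
    have x0 : 0 < k%:R :> R by rewrite ltr0n.
    by rewrite mulrA /v -powRDp// addNr powRr0 mul1r.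
  rewrite -/s sq.
  have := @jensen_pow R _ s' v (fun k => k%:R `^ 2^-1 * Y k) q v0.
  move=> /(_ (fun k => mulr_ge0 (powR_ge0 _ _) (Y0 k))) /le_trans; apply.
  rewrite ler_wpM2l ?exprn_ge0//.
  rewrite big_seq [leRHS]big_seq; apply: ler_sum => k /mem k1.
  rewrite /f ler_wpM2l//.
  have x0 : 0 < k%:R :> R by rewrite ltr0n.
  rewrite /Y mulrDr -sq.
  apply: (le_trans (powD_le _ _ _)).
  + by rewrite !mulr_ge0 ?powR_ge0// ltW.
  + by rewrite !mulr_ge0 ?powR_ge0 ?sqr_ge0// ltW.
  rewrite /c1 /c2 mulrDr; apply: lerD.
    rewrite -[leRHS]mulrA; apply: ler_wpM2l; first exact: ltW.
    rewrite le_eqVlt; apply/orP; left; apply/eqP.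
    have -> : k%:R `^ 2^-1 * (A * k%:R `^ (al - 1) * r k w) =
        A * k%:R `^ (al - 2^-1) * r k w.
      rewrite (_ : al - 2^-1 = 2^-1 + (al - 1)); last by field.
      by rewrite (powRDp 2^-1 (al - 1) x0); ring.
    rewrite !exprMn powRXn ?ltW//; congr (_ * _ `^ _ * _).
    by rewrite /s natrM; field.
  rewrite -[leRHS]mulrA; apply: ler_wpM2l; first exact: ltW.
  have E : (k%:R `^ 2^-1) ^+ s = k%:R ^+ p :> R.
    by rewrite powRXn ?ltW// /s natrM mulrA mulVf// mul1r powR_mulrn ?ltW.
  by rewrite exprMn E exprMn -exprM mulrCA mulrA.
- have Ws : Ex P (fun w => W ^+ q * \sum_(k <- s') f k w) <= W ^+ q * (W * K0).
    rewrite (ExZ _ sumi) sumE ler_wpM2l ?exprn_ge0// /W mulr_suml big_seq [leRHS]big_seq.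
    by apply: ler_sum => k /mem k1; case: (fint k k1).
  apply: (le_trans Ws); rewrite mulrA -exprSr -sq mulrAC.
  rewrite ler_wpM2r ?(ltW K00)//.
  apply: (@le_trans _ _ ((2 * n%:R `^ 2^-1) ^+ s)).
    by rewrite lerXn2r ?nnegrE ?mulr_ge0 ?powR_ge0// sum_inv_sqrt_le.
  by rewrite exprMn powRXn// /s natrM mulrA mulVf// mul1r powR_mulrn.
Qed.

End averaging.

(** * The stochastic gradient algorithm *)

Section stochastic_gradient.
Context {R : realType} {H : completeNormedModType R} (dot : {dot H for idfun}).
Context (dotE : hilbert_dot dot) (Hsep : separable H).
Context {d d' : measure_display} {Omega : measurableType d} {XX : measurableType d'}
  (P : probability Omega R).
Context (X : {RV P >-> XX}) (Xs : nat -> {RV P >-> XX}).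
Context (Xs_indep : mutually_independent P [set n | (1 <= n)%N]
  (fun n => Xs n : Omega -> XX)).
Context (Xs_law : forall n, (1 <= n)%N -> same_law (Xs n) X).
Context (grad_g : XX -> H -> H) (grad_G : H -> H) (m : H).
Context (grad_g_meas : measurable_fun setT
  ((fun z => grad_g z.1 z.2) : XX * borel H -> borel H)).
Context (grad_G_meas : measurable_fun setT (grad_G : borel H -> borel H)).
Context (grad_G_mean : forall h u,
  (\int[P]_w (dot (grad_g (X w) h) u)%:E = (dot (grad_G h) u)%:E)%E).
Context (grad_g_moments : forall q, exists2 L : R, 0 < L & forall h,
  (\int[P]_w (`|grad_g (X w) h| ^+ (2 * q.+1))%:E
    <= (L * (1 + `|h - m| ^+ (2 * q.+1)))%:E)%E).
Context (c : R) (c_gt0 : 0 < c).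
Context (drift : forall A h, 1 <= A -> `|h - m| <= A ->
  c / A * `|h - m| ^+ 2 <= dot (grad_G h) (h - m)).
Context (cg alpha : R) (cg_gt0 : 0 < cg) (alpha_gt : 2^-1 < alpha) (alpha_lt1 : alpha < 1).
Context (gamma : nat -> R)
  (gamma_def : forall n, (1 <= n)%N -> gamma n = cg * n%:R `^ (- alpha)).
Context (Z : nat -> Omega -> H).
Context (Z1_past : measurable_fun setT (Z 1%N : past Xs 1 -> borel H)).
Context (Z1_bounded : exists M : R, {ae P, forall w, `|Z 1%N w| <= M}).
Context (Z_rec : forall n w, (1 <= n)%N ->
  Z n.+1 w = Z n w - gamma n *: grad_g (Xs n.+1 w) (Z n w)).

Lemma gamma_gt0 n : (1 <= n)%N -> 0 < gamma n.
Proof. by move=> n1; rewrite gamma_def// mulr_gt0// powR_gt0// ltr0n. Qed.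

Lemma gamma_le n : (1 <= n)%N -> gamma n <= cg.
Proof.
move=> n1; rewrite gamma_def// ger_pMr// -[leRHS](powRr0 n%:R) ler_powR ?ler1n//.
by rewrite oppr_le0; have := alpha_gt; lra.
Qed.

Lemma grad_g_obs_measurable h : measurable_fun setT
  ((fun w => grad_g (X w) h) : Omega -> borel H).
Proof.
have := measurable_fun_pair1 (h : borel H) grad_g_meas => mg.
exact: (measurableT_comp mg).
Qed.

Lemma Z_past n : (1 <= n)%N -> measurable_fun setT (Z n : past Xs n -> borel H).
Proof.
case: n => // n _; elim: n => [//|n IH].
have mZ := past_le (leqnSn n.+1) IH.
have -> : Z n.+2 = fun w => Z n.+1 w - gamma n.+1 *: grad_g (Xs n.+2 w) (Z n.+1 w).
  by apply/funext => w; rewrite Z_rec.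
apply: borel_measurable_sub => //; apply: borel_measurable_scale.
have mp : measurable_fun setT
    ((fun w => (Xs n.+2 w, Z n.+1 w)) : past Xs n.+2 -> XX * borel H).
  by apply: measurable_fun_pair => //; apply: past_observation; rewrite leqnn.
exact: (measurableT_comp grad_g_meas mp).
Qed.

Lemma Z_measurable n : (1 <= n)%N -> measurable_fun setT (Z n : Omega -> borel H).
Proof. by move=> /Z_past; exact: past_measurable. Qed.

Lemma sgd_step_bound p : exists2 D, 0 < D & forall n h, (1 <= n)%N ->
  (\int[P]_w (`|h - gamma n *: grad_g (X w) h - m| ^+ (2 * p.+1))%:E <=
   (`|h - m| ^+ (2 * p.+1)
     - 2 * p.+1%:R * gamma n * (`|h - m| ^+ (2 * p) * dot (grad_G h) (h - m))
     + D * (gamma n ^+ 2 * `|h - m| ^+ (2 * p) + gamma n ^+ 2 * `|h - m| ^+ (2 * p.+1)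
            + gamma n ^+ (2 * p.+1)))%:E)%E.
Proof.
have [C C0 HC] := expect_pow_norm_sub_le dotE Hsep P p.
have [L0 L00 HL0] := grad_g_moments 0; have [L L_gt0 HL] := grad_g_moments p.
have cg2 : 0 <= cg ^+ (2 * p) by rewrite exprn_ge0// ltW.
(* [L0] bounds the second moment and [L] the moment of order 2(p+1); the factor gamma^(2p) <=
   cg^(2p) reduces the highest-order term to weight gamma^2. *)
exists (C * (L0 + L * (1 + cg ^+ (2 * p)))).
  by rewrite mulr_gt0// addr_gt0// mulr_gt0//; lra.
move=> n h n1; have g0 := gamma_gt0 n1; have gcg := gamma_le n1.
set g := gamma n in g0 gcg *; set r := `|h - m|; have r0 : 0 <= r by exact: normr_ge0.
have mY := grad_g_obs_measurable h.
have mgY := borel_measurable_scale g mY.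
have moment q (B : R) :
    (\int[P]_w (`|grad_g (X w) h| ^+ (2 * q))%:E <= B%:E)%E ->
    (\int[P]_w (`|g *: grad_g (X w) h| ^+ (2 * q))%:E <= (g ^+ (2 * q) * B)%:E)%E.
  move=> HB; have -> : (\int[P]_w (`|g *: grad_g (X w) h| ^+ (2 * q))%:E =
      \int[P]_w ((g ^+ (2 * q))%:E * (`|grad_g (X w) h| ^+ (2 * q))%:E))%E.
    by apply: eq_integral => w _; rewrite normrZ exprMn (gtr0_norm g0) EFinM.
  rewrite ge0_integralZl//.
  - by rewrite EFinM; apply: lee_wpmul2l => //; rewrite lee_fin exprn_ge0// ltW.
  - by apply/measurable_EFinP; apply: measurable_funX; exact: borel_measurable_norm.
  - by rewrite lee_fin exprn_ge0// ltW.
have mean : (\int[P]_w (dot (g *: grad_g (X w) h) (h - m))%:E =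
    (dot (g *: grad_G h) (h - m))%:E)%E.
  rewrite dotZl EFinM -grad_G_mean.
  have [i _] : integrableR P (fun w => `|grad_g (X w) h| ^+ 2) /\
      Ex P (fun w => `|grad_g (X w) h| ^+ 2) <= L0 * (1 + r ^+ 2).
    apply: integrableR_of_le; [|by []|exact: HL0].
    by apply: measurable_funX; exact: borel_measurable_norm.
  rewrite -integralZl//.
    by apply: eq_integral => w _; rewrite dotZl EFinM.
  apply: (@integrableR_le _ _ _ _ _ (fun w => r * (1 + `|grad_g (X w) h| ^+ 2))).
  - by apply: borel_measurable_dot => //; exact: measurable_cst.
  - move=> w; apply: (le_trans (dot_cauchy_schwarz dotE _ _)).
    rewrite mulrC ler_wpM2l//; set y := `|grad_g (X w) h|.
    have y0 : 0 <= y by exact: normr_ge0.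
    by have := sqr_ge0 (y - 1); rewrite sqrrB1; lra.
  - by apply: integrableRZ; apply: integrableRD => //; exact: integrableR_cst.
have := HC _ (h - m) _ _ _ mgY mean (moment 1%N _ (HL0 h)) (moment p.+1 _ (HL h)).
rewrite dotZl -/r !muln1.
have -> : (fun w => (`|h - m - g *: grad_g (X w) h| ^+ (2 * p.+1))%:E) =
    (fun w => (`|h - g *: grad_g (X w) h - m| ^+ (2 * p.+1))%:E).
  by apply/funext => w; rewrite addrAC.
move=> /le_trans; apply; rewrite lee_fin.
have -> : r ^+ (2 * p.+1) = r ^+ (2 * p) * r ^+ 2 by rewrite mulnS addnC exprD.
have -> : g ^+ (2 * p.+1) = g ^+ (2 * p) * g ^+ 2 by rewrite mulnS addnC exprD.
set Q := r ^+ (2 * p); set S := g ^+ (2 * p).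
have Q0 : 0 <= Q by apply: exprn_ge0.
have S0 : 0 <= S by apply: exprn_ge0; exact: ltW.
have Scg : S <= cg ^+ (2 * p) by rewrite lerXn2r ?nnegrE// ltW.
set V := cg ^+ (2 * p) in Scg cg2 *.
have G0 : 0 <= g ^+ 2 by exact: sqr_ge0.
have r20 : 0 <= r ^+ 2 by exact: sqr_ge0.
set G2 := g ^+ 2 in G0 *; set r2 := r ^+ 2 in r20 *.
have -> : Q * r2 - 2 * p.+1%:R * Q * (g * dot (grad_G h) (h - m)) +
   C * (Q * (G2 * (L0 * (1 + r2))) + S * G2 * (L * (1 + Q * r2))) =
   Q * r2 - 2 * p.+1%:R * g * (Q * dot (grad_G h) (h - m)) +
   C * (L0 * (G2 * Q + G2 * (Q * r2)) + L * (S * G2 + S * (G2 * (Q * r2)))) by ring.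
rewrite lerD2l -(mulrA C); apply: ler_wpM2l; first exact: ltW.
have k0 : 0 <= G2 * (Q * r2) by rewrite mulr_ge0// mulr_ge0.
have k1 : S * (G2 * (Q * r2)) <= V * (G2 * (Q * r2)) by rewrite ler_wpM2r.
have k2 : 0 <= S * G2 by rewrite mulr_ge0.
have k3 : 0 <= G2 * Q by rewrite mulr_ge0.
have k4 := ler_wpM2l (ltW L_gt0) k1.
have k5 := mulr_ge0 (ltW L00) k2.
have k6 := mulr_ge0 (ltW L_gt0) k3.
have k7 := mulr_ge0 (ltW L_gt0) k0.
have k8 := mulr_ge0 k6 cg2.
have k9 := mulr_ge0 (mulr_ge0 (ltW L_gt0) k2) cg2.
lra.
Qed.

Lemma drift_power_bound p q (A : R) h : 1 <= A ->
  c / A * (`|h - m| ^+ (2 * p.+1) - `|h - m| ^+ (2 * (p.+1 + q)) / A ^+ (2 * q))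
  <= `|h - m| ^+ (2 * p) * dot (grad_G h) (h - m).
Proof.
move=> A1; set r := `|h - m|; have r0 : 0 <= r by exact: normr_ge0.
have A0 : 0 < A by lra.
have cA0 : 0 <= c / A by rewrite divr_ge0// ltW.
have E : r ^+ (2 * p.+1) = r ^+ (2 * p) * r ^+ 2 by rewrite mulnS addnC exprD.
have q0 : 0 <= r ^+ (2 * (p.+1 + q)) / A ^+ (2 * q).
  by rewrite divr_ge0// exprn_ge0// ltW.
have [rA|Ar] := leP r A.
  have h1 := drift A1 rA; rewrite -/r in h1.
  apply: (@le_trans _ _ (c / A * r ^+ (2 * p.+1))).
    by rewrite ler_wpM2l// lerBlDr lerDl.
  by rewrite E mulrCA; apply: ler_wpM2l => //; exact: exprn_ge0.
apply: (@le_trans _ _ 0).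
  rewrite mulr_ge0_le0// subr_le0 mulnDr exprD -mulrA ler_peMr ?exprn_ge0//.
  by rewrite ler_pdivlMr ?exprn_gt0// mul1r lerXn2r ?nnegrE// ltW.
rewrite mulr_ge0 ?exprn_ge0//.
have r1 : 1 <= r by lra.
apply: le_trans (drift r1 (lexx _)).
by rewrite mulr_ge0 ?sqr_ge0// divr_ge0// ltW.
Qed.

Definition dist n w := `|Z n w - m|.

Lemma dist_ge0 n w : 0 <= dist n w.
Proof. exact: normr_ge0. Qed.

Lemma dist_measurable n : (1 <= n)%N -> measurable_fun setT (dist n).
Proof.
move=> n1; apply: borel_measurable_norm; apply: borel_measurable_sub => //.
exact: Z_measurable.
Qed.

Lemma sgd_transfer n p (psi : R -> R) : (1 <= n)%N ->
  (forall h, (\int[P]_w (`|h - gamma n *: grad_g (X w) h - m| ^+ (2 * p))%:E <=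
    (psi `|h - m|)%:E)%E) ->
  integrableR P (psi \o dist n) ->
  integrableR P (fun w => dist n.+1 w ^+ (2 * p)) /\
  Ex P (fun w => dist n.+1 w ^+ (2 * p)) <= Ex P (psi \o dist n).
Proof.
move=> n1 Hpsi ipsi.
pose phi (z : XX * borel H) :=
  `|(z.2 : H) - gamma n *: grad_g z.1 z.2 - m| ^+ (2 * p).
have -> : (fun w => dist n.+1 w ^+ (2 * p)) = fun w => phi (Xs n.+1 w, Z n w).
  by apply/funext => w; rewrite /phi /dist Z_rec.
apply: (@next_observation_le _ _ _ P _ _ X Xs Xs_indep Xs_law _ _ n
  (Z n : Omega -> borel H) phi (fun h : borel H => psi `|(h : H) - m|)) => //.
- exact: Z_past.
- rewrite /phi; apply: measurable_funX; apply: borel_measurable_norm.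
  apply: borel_measurable_sub => //.
  apply: borel_measurable_sub => //; apply: borel_measurable_scale.
  exact: grad_g_meas.
- by move=> z; exact: exprn_ge0.
Qed.

Lemma dist_moment_integrable n p : (1 <= n)%N ->
  integrableR P (fun w => dist n w ^+ (2 * p)).
Proof.
case: n => // n _; elim: n p => [|n IH] p.
  have [M HM] := Z1_bounded.
  suff /integrableR_of_le[] : (\int[P]_w (dist 1 w ^+ (2 * p))%:E <=
      ((`|M| + `|m|) ^+ (2 * p))%:E)%E => //.
  - by apply: measurable_funX; exact: dist_measurable.
  - by move=> w; rewrite exprn_ge0 ?dist_ge0.
  have -> : (((`|M| + `|m|) ^+ (2 * p))%:E =
      \int[P]_w (cst ((`|M| + `|m|) ^+ (2 * p))%:E w))%E.
    by rewrite integral_cst// [X in (_ * X)%E]probability_setT mule1.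
  apply: ae_ge0_le_integral => //.
  - by move=> w _; rewrite lee_fin exprn_ge0 ?dist_ge0.
  - by apply/measurable_EFinP; apply: measurable_funX; exact: dist_measurable.
  - by move=> w _; rewrite lee_fin exprn_ge0// addr_ge0.
  - apply: filterS HM => w Zw _; rewrite lee_fin lerXn2r ?nnegrE ?addr_ge0 ?dist_ge0//.
    apply: (le_trans (ler_normB _ _)); rewrite lerD2r (le_trans Zw)// ler_norm//.
case: p => [|p].
  rewrite (_ : (fun w => _) = fun=> 1); first exact: integrableR_cst.
  by apply/funext => w; rewrite muln0 expr0.
have [D D0 HD] := sgd_step_bound p.
have n1 : (1 <= n.+1)%N by [].
have g0 := gamma_gt0 n1.
have [] // := @sgd_transfer n.+1 p.+1 (fun r => r ^+ (2 * p.+1) +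
  D * (gamma n.+1 ^+ 2 * r ^+ (2 * p) + gamma n.+1 ^+ 2 * r ^+ (2 * p.+1)
       + gamma n.+1 ^+ (2 * p.+1))) n1.
  move=> h; apply: (le_trans (HD n.+1 h n1)); rewrite lee_fin lerD2r.
  rewrite gerDl oppr_le0 mulr_ge0// ?mulr_ge0 ?exprn_ge0 ?(ltW g0)//.
  (* The radius 1 + |h - m| is admissible for every h; only the sign of the drift is wanted here. *)
  have A1 : 1 <= 1 + `|h - m| by rewrite lerDl.
  apply: le_trans (drift A1 _); last by rewrite lerDr.
  by rewrite mulr_ge0 ?sqr_ge0// divr_ge0 ?(ltW c_gt0)// addr_ge0.
rewrite /comp/=; apply: integrableRD; first exact: IH.
apply: integrableRZ; apply: integrableRD; last exact: integrableR_cst.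
by apply: integrableRD; apply: integrableRZ; exact: IH.
Qed.

Lemma sgd_rate p : exists2 K, 0 < K & forall n, (1 <= n)%N ->
  Ex P (fun w => dist n w ^+ (2 * p)) <= K * n%:R `^ (- (alpha * p%:R)).
Proof.
(* The algorithm starts at index 1, whereas the sequence hypotheses range over all n. The value at 0
   (1 for p = 0, else 0) meets both the normalization and the Young inequality. *)
pose U p n := if n is 0%N then (p == 0%N)%:R else Ex P (fun w => dist n w ^+ (2 * p)).
have UE q n : (1 <= n)%N -> U q n = Ex P (fun w => dist n w ^+ (2 * q)) by case: n.
have Ui q n : (1 <= n)%N -> integrableR P (fun w => dist n w ^+ (2 * q)).
  exact: dist_moment_integrable.
have [] // := @moment_rates R alpha cg U alpha_gt alpha_lt1 cg_gt0 _ _ _ _ _ p.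
- by move=> q [|n] /=; [case: eqP|apply: Ex_ge0 => w; exact/exprn_ge0/dist_ge0].
- move=> [|n] //=; rewrite (_ : (fun w => _) = fun=> 1) ?Ex_cst//.
- move=> q [|n] y y0 /=.
    by case: q => [|q] /=; rewrite mulr0 add0r ?expr0 ?invr1// invr_ge0 exprn_ge0// ltW.
  have n1 : (1 <= n.+1)%N by [].
  rewrite -ExZ; last exact: Ui.
  rewrite -[y ^- q](Ex_cst P) -ExD; last 2 first.
    by apply: integrableRZ; exact: Ui.
    exact: integrableR_cst.
  apply: Ex_le; first exact: Ui.
    by apply: integrableRD; [apply: integrableRZ; exact: Ui|exact: integrableR_cst].
  move=> w; have := @young_pow R q 1 (dist n.+1 w ^+ 2) y ler01 (sqr_ge0 _) y0.
  by rewrite mul1r expr1n mulr1 -!exprM.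
- move=> q; have [D D0 HD] := sgd_step_bound q; exists D => // n n1 /=.
  rewrite -gamma_def// !UE//; have g0 := gamma_gt0 n1; set g := gamma n in HD g0 *.
  have [||_ /le_trans] := @sgd_transfer n q.+1 (fun r => r ^+ (2 * q.+1) +
    D * (g ^+ 2 * r ^+ (2 * q) + g ^+ 2 * r ^+ (2 * q.+1) + g ^+ (2 * q.+1))) n1.
  + move=> h; apply: (le_trans (HD n h n1)); rewrite lee_fin lerD2r.
    rewrite gerDl oppr_le0 mulr_ge0// ?mulr_ge0 ?exprn_ge0 ?(ltW g0)//.
    have A1 : 1 <= 1 + `|h - m| by rewrite lerDl.
    apply: le_trans (drift A1 _); last by rewrite lerDr.
    by rewrite mulr_ge0 ?sqr_ge0// divr_ge0 ?(ltW c_gt0)// addr_ge0.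
  + apply: integrableRD; first exact: Ui.
    apply: integrableRZ; apply: integrableRD; last exact: integrableR_cst.
    by apply: integrableRD; apply: integrableRZ; exact: Ui.
  apply; rewrite /comp/=.
  have i1 := integrableRZ (g ^+ 2) (Ui q n n1).
  have i2 := integrableRZ (g ^+ 2) (Ui q.+1 n n1).
  have i3 := @integrableR_cst _ _ _ P (g ^+ (2 * q.+1)).
  have i12 := integrableRD i1 i2; have i123 := integrableRD i12 i3.
  have iD := integrableRZ D i123.
  rewrite (ExD (Ui q.+1 n n1) iD) (ExZ D i123) (ExD i12 i3) (ExD i1 i2).
  by rewrite (ExZ _ (Ui q n n1)) (ExZ _ (Ui q.+1 n n1)) Ex_cst.
- move=> q; have [D D0 HD] := sgd_step_bound q.
  exists (2 * q.+1%:R * c), D; split => //; first by rewrite mulr_gt0// mulr_gt0.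
  move=> n A s n1 A1 /=; rewrite -gamma_def// !UE//.
  have g0 := gamma_gt0 n1; set g := gamma n in HD g0 *.
  set k := 2 * q.+1%:R * c * (g / A).
  have [||_ /le_trans] := @sgd_transfer n q.+1 (fun r => (r ^+ (2 * q.+1) +
    (- k) * (r ^+ (2 * q.+1) + (- A ^- (2 * s)) * r ^+ (2 * (q.+1 + s)))) +
    D * (g ^+ 2 * r ^+ (2 * q) + g ^+ 2 * r ^+ (2 * q.+1) + g ^+ (2 * q.+1))) n1.
  + move=> h; apply: (le_trans (HD n h n1)); rewrite lee_fin lerD2r lerD2l mulNr lerN2.
    have := drift_power_bound q s h A1; rewrite mulNr [A ^- _ * _]mulrC => h1.
    rewrite /k.
    have -> : 2 * q.+1%:R * c * (g / A) = 2 * q.+1%:R * g * (c / A) by ring.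
    rewrite -(mulrA (2 * q.+1%:R * g)); apply: ler_wpM2l => //.
    by rewrite mulr_ge0 ?(ltW g0)// mulr_ge0.
  + apply: integrableRD.
      apply: integrableRD; first exact: Ui.
      apply: integrableRZ; apply: integrableRD; first exact: Ui.
      by apply: integrableRZ; exact: Ui.
    apply: integrableRZ; apply: integrableRD; last exact: integrableR_cst.
    by apply: integrableRD; apply: integrableRZ; exact: Ui.
  apply; rewrite /comp/=.
  have i1 := integrableRZ (g ^+ 2) (Ui q n n1).
  have i2 := integrableRZ (g ^+ 2) (Ui q.+1 n n1).
  have i3 := @integrableR_cst _ _ _ P (g ^+ (2 * q.+1)).
  have i12 := integrableRD i1 i2; have i123 := integrableRD i12 i3.
  have iD := integrableRZ D i123.
  have i4 := integrableRZ (- A ^- (2 * s)) (Ui (q.+1 + s)%N n n1).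
  have i5 := integrableRD (Ui q.+1 n n1) i4.
  have i6 := integrableRZ (- k) i5.
  have i7 := integrableRD (Ui q.+1 n n1) i6.
  rewrite (ExD i7 iD) (ExD (Ui q.+1 n n1) i6) (ExZ _ i5) (ExD (Ui q.+1 n n1) i4).
  rewrite (ExZ _ (Ui (q.+1 + s)%N n n1)) (ExZ D i123) (ExD i12 i3) (ExD i1 i2).
  rewrite (ExZ _ (Ui q n n1)) (ExZ _ (Ui q.+1 n n1)) Ex_cst.
  by rewrite mulNr mulNr [_^-1 * _]mulrC.
- move=> K K0 KP; exists K => // n n1; have := KP n n1; rewrite UE//.
Qed.

(** * Moments of the noise martingale *)

Context (Lin : R) (Lin_gt0 : 0 < Lin)
  (grad_G_lin : forall h, `|grad_G h| <= Lin * (1 + `|h - m|)).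

Lemma noise_moments q : exists2 L : R, 0 < L & forall h,
  (\int[P]_w (`|grad_g (X w) h - grad_G h| ^+ (2 * q.+1))%:E
    <= (L * (1 + `|h - m| ^+ (2 * q.+1)))%:E)%E.
Proof.
have [L L0 HL] := grad_g_moments q; set s := (2 * q.+1)%N in HL *.
have two0 : 0 < 2 ^+ s :> R by rewrite exprn_gt0.
have Ls0 : 0 < Lin ^+ s by rewrite exprn_gt0.
exists (2 ^+ s * (L + Lin ^+ s * 2 ^+ s)).
  by rewrite mulr_gt0// addr_gt0// mulr_gt0.
move=> h; have mY := grad_g_obs_measurable h.
have mn : measurable_fun setT (fun w => `|grad_g (X w) h| ^+ s).
  by apply: measurable_funX; exact: borel_measurable_norm.
have [i E] : integrableR P (fun w => `|grad_g (X w) h| ^+ s) /\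
    Ex P (fun w => `|grad_g (X w) h| ^+ s) <= L * (1 + `|h - m| ^+ s).
  by apply: integrableR_of_le => // w; rewrite exprn_ge0.
have i2 := integrableRZ (2 ^+ s) (integrableRD i (integrableR_cst P (`|grad_G h| ^+ s))).
have le w : `|grad_g (X w) h - grad_G h| ^+ s <=
    2 ^+ s * (`|grad_g (X w) h| ^+ s + `|grad_G h| ^+ s).
  apply: le_trans (powD_le _ _ _) => //.
  by rewrite lerXn2r ?nnegrE ?addr_ge0// ler_normB.
have il : integrableR P (fun w => `|grad_g (X w) h - grad_G h| ^+ s).
  apply: integrableR_le i2 => [|w]; last by rewrite ger0_norm ?exprn_ge0.
  by apply: measurable_funX; apply: borel_measurable_norm; apply: borel_measurable_sub.
rewrite Ex_EFin// lee_fin (le_trans (Ex_le il i2 le))//.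
rewrite (ExZ _ (integrableRD i (integrableR_cst P _))) (ExD i (integrableR_cst P _)) Ex_cst.
rewrite -mulrA ler_wpM2l ?(ltW two0)// mulrDl lerD//.
have r0 : 0 <= `|h - m| by [].
apply: (@le_trans _ _ ((Lin * (1 + `|h - m|)) ^+ s)).
  rewrite lerXn2r ?nnegrE//; first by rewrite mulr_ge0 ?addr_ge0// ltW.
rewrite exprMn -mulrA ler_wpM2l ?(ltW Ls0)//.
by apply: (le_trans (powD_le s ler01 r0)); rewrite expr1n.
Qed.

(** The partial sums of the increments xi_k. The k-th increment involves [Xs k.+1], so [mart n] is
    adapted to [past n.+1] rather than [past n]. *)
Definition mart n w :=
  \sum_(1 <= k < n.+1) (grad_G (Z k w) - grad_g (Xs k.+1 w) (Z k w)).

Lemma martS n w : mart n.+1 w =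
  mart n w - (grad_g (Xs n.+2 w) (Z n.+1 w) - grad_G (Z n.+1 w)).
Proof. by rewrite /mart big_nat_recr//= opprB. Qed.

Lemma mart_past n : measurable_fun setT (mart n : past Xs n.+1 -> borel H).
Proof.
elim: n => [|n IH].
  rewrite (_ : mart 0 = cst 0); first exact: measurable_cst.
  by apply/funext => w; rewrite /mart big_geq.
have mZ := past_le (leqnSn n.+1) (Z_past (isT : (1 <= n.+1)%N)).
have -> : mart n.+1 = fun w => mart n w -
    (grad_g (Xs n.+2 w) (Z n.+1 w) - grad_G (Z n.+1 w)).
  by apply/funext => w; rewrite martS.
have mp : measurable_fun setT
    ((fun w => (Xs n.+2 w, Z n.+1 w)) : past Xs n.+2 -> XX * borel H).
  by apply: measurable_fun_pair => //; apply: past_observation; rewrite leqnn.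
apply: borel_measurable_sub => //; first exact: past_le IH.
apply: borel_measurable_sub => //.
  exact: (measurableT_comp grad_g_meas mp).
exact: (measurableT_comp grad_G_meas mZ).
Qed.

(** The noise has mean 0, so no first-order term survives. Young's inequality with a parameter of
    order 1/N lets the moment grow only by the factor 1 + 1/(2N), at the price of a source of order
    N^p. *)
Lemma mart_step_bound p : exists2 D : R, 0 < D & forall (N : R) (h u : H), 1 <= N ->
  (\int[P]_w (`|u - (grad_g (X w) h - grad_G h)| ^+ (2 * p.+1))%:E <=
   ((1 + (2 * N)^-1) * `|u| ^+ (2 * p.+1) + D * N ^+ p * (1 + `|h - m| ^+ (2 * p.+1)))%:E)%E.
Proof.
have [C C0 HC] := expect_pow_norm_sub_le dotE Hsep P p.
have [L1 L10 HL1] := noise_moments 0; have [L L0 HL] := noise_moments p.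
pose k := C * L1; have k0 : 0 < k by rewrite mulr_gt0.
exists (k * (2 * k) ^+ p * 2 ^+ p.+1 + C * L).
  by rewrite addr_gt0// ?mulr_gt0 ?exprn_gt0 ?mulr_gt0.
move=> N h u N1; have N0 : 0 < N by lra.
have mY : measurable_fun setT
    ((fun w => grad_g (X w) h - grad_G h) : Omega -> borel H).
  apply: borel_measurable_sub => //; exact: grad_g_obs_measurable.
have mean : (\int[P]_w (dot (grad_g (X w) h - grad_G h) u)%:E = (dot 0 u)%:E)%E.
  have [i _] : integrableR P (fun w => `|grad_g (X w) h - grad_G h| ^+ 2) /\
      Ex P (fun w => `|grad_g (X w) h - grad_G h| ^+ 2) <= L1 * (1 + `|h - m| ^+ 2).
    apply: integrableR_of_le; [|by []|exact: HL1].
    by apply: measurable_funX; exact: borel_measurable_norm.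
  have i1 : integrableR P (fun w => dot (grad_g (X w) h - grad_G h) u).
    apply: (@integrableR_le _ _ _ _ _
      (fun w => `|u| * (1 + `|grad_g (X w) h - grad_G h| ^+ 2))).
    - by apply: borel_measurable_dot => //; exact: measurable_cst.
    - move=> w; apply: (le_trans (dot_cauchy_schwarz dotE _ _)).
      rewrite mulrC ler_wpM2l//; set y := `|grad_g (X w) h - _|.
      have y0 : 0 <= y by exact: normr_ge0.
      by have := sqr_ge0 (y - 1); rewrite sqrrB1; lra.
    - by apply: integrableRZ; apply: integrableRD => //; exact: integrableR_cst.
  have i2 := integrableRD i1 (integrableR_cst P (dot (grad_G h) u)).
  have E : Ex P (fun w => dot (grad_g (X w) h - grad_G h) u + dot (grad_G h) u) =
      dot (grad_G h) u.
    apply: EFin_inj; rewrite -Ex_EFin// -grad_G_mean.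
    by apply: eq_integral => w _; rewrite dotBl subrK.
  rewrite Ex_EFin//; congr (_%:E); rewrite linear0l.
  move: E; rewrite (ExD i1 (integrableR_cst P _)) Ex_cst; lra.
apply: (le_trans (HC _ u 0 _ _ mY mean (HL1 h) (HL h))); rewrite lee_fin linear0l mulr0 subr0.
set r := `|h - m|; set M := `|u|.
have r0 : 0 <= r ^+ 2 by exact: sqr_ge0.
have rp0 : 0 <= r ^+ (2 * p.+1) by rewrite exprM exprn_ge0.
pose y := (2 * N * k)^-1; have y0 : 0 < y by rewrite invr_gt0 !mulr_gt0.
have := @young_pow R p (1 + r ^+ 2) (M ^+ 2) y (addr_ge0 ler01 r0) (sqr_ge0 M) y0.
rewrite -!exprM.
have -> : y ^- p = N ^+ p * (2 * k) ^+ p.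
  by rewrite /y -exprVn invrK -exprMn; congr (_ ^+ p); ring.
move=> Y.
have P2 : (1 + r ^+ 2) ^+ p.+1 <= 2 ^+ p.+1 * (1 + r ^+ (2 * p.+1)).
  by apply: (le_trans (powD_le _ ler01 r0)); rewrite expr1n -exprM.
have NK0 : 0 <= k * (N ^+ p * (2 * k) ^+ p).
  by apply: ltW; rewrite !mulr_gt0 ?exprn_gt0 ?mulr_gt0.
have h1 := ler_wpM2l (ltW k0) Y.
have h2 := ler_wpM2l NK0 P2.
have h3 : k * (y * M ^+ (2 * p.+1)) = (2 * N)^-1 * M ^+ (2 * p.+1).
  by rewrite /y; field; rewrite !gt_eqF.
have N1p : 1 <= N ^+ p by rewrite exprn_ege1.
have CL0 : 0 <= C * L * (1 + r ^+ (2 * p.+1)) by rewrite !mulr_ge0 ?addr_ge0// ltW.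
have h4 := ler_wpM2l CL0 N1p.
have -> : C * (M ^+ (2 * p) * (L1 * (1 + r ^+ (2 * 1))) + L * (1 + r ^+ (2 * p.+1))) =
    k * ((1 + r ^+ 2) * M ^+ (2 * p)) + C * L * (1 + r ^+ (2 * p.+1)).
  by rewrite /k muln1; ring.
move: h1; rewrite mulrDr h3 => h1.
rewrite [(1 + (2 * N)^-1) * _]mulrDl mul1r -addrA lerD2l.
apply: (le_trans (lerD h1 (lexx _))).
rewrite -addrA lerD2l.
apply: (@le_trans _ _ (k * (N ^+ p * (2 * k) ^+ p) * (2 ^+ p.+1 * (1 + r ^+ (2 * p.+1)))
   + C * L * (1 + r ^+ (2 * p.+1)) * N ^+ p)); last first.
  by rewrite le_eqVlt; apply/orP; left; apply/eqP; ring.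
apply: lerD; last by move: h4; rewrite mulr1.
by move: h2; rewrite -!mulrA.
Qed.

Lemma mart_moment p : exists2 K, 0 < K & forall n,
  integrableR P (fun w => `|mart n w| ^+ (2 * p.+1)) /\
  Ex P (fun w => `|mart n w| ^+ (2 * p.+1)) <= K * n%:R ^+ p.+1.
Proof.
have [D D0 HD] := mart_step_bound p; have [Kr Kr0 HKr] := sgd_rate p.+1.
pose B := D * (1 + Kr); have B0 : 0 < B by rewrite mulr_gt0// addr_gt0.
(* With N = n+1, one [B] N^p pays for the noise and the other for the growth factor; the induction
   closes because n^(p+1) + N^p <= N^(p+1). *)
exists (2 * B); first by rewrite mulr_gt0.
elim=> [|n [IHi IH]].
  rewrite (_ : (fun w => _) = fun=> 0).
    by split; [exact: integrableR_cst|rewrite Ex_cst expr0n/= mulr0].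
  by apply/funext => w; rewrite /mart big_geq// normr0 expr0n muln_eq0.
pose N : R := n.+1%:R; have N1 : 1 <= N by rewrite /N ler1n.
have N0 : 0 < N by lra.
have Np0 : 0 < N ^+ p by rewrite exprn_gt0.
have ir : integrableR P (fun w => dist n.+1 w ^+ (2 * p.+1)) by exact: dist_moment_integrable.
have Er : Ex P (fun w => dist n.+1 w ^+ (2 * p.+1)) <= Kr.
  apply: (le_trans (HKr n.+1 isT)); rewrite ger_pMr//.
  rewrite -[leRHS](powRr0 N) ler_powR// oppr_le0 mulr_ge0//; have := alpha_gt; lra.
pose phi (z : XX * (borel H * borel H)) :=
  `|(z.2.2 : H) - (grad_g z.1 z.2.1 - grad_G z.2.1)| ^+ (2 * p.+1).
pose psi (z : borel H * borel H) := (1 + (2 * N)^-1) * `|z.2 : H| ^+ (2 * p.+1)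
  + D * N ^+ p * (1 + `|(z.1 : H) - m| ^+ (2 * p.+1)).
pose W w : borel H * borel H := (Z n.+1 w, mart n w).
have j1 := integrableRZ (1 + (2 * N)^-1) IHi.
have j2 := integrableRD (integrableR_cst P 1) ir.
have j3 := integrableRZ (D * N ^+ p) j2.
have ipsi : integrableR P (psi \o W) by have := integrableRD j1 j3.
have [] // := @next_observation_le _ _ _ P _ _ X Xs Xs_indep Xs_law _ _ n.+1 W phi psi
  _ _ _ _ ipsi.
- apply: measurable_fun_pair; [exact: Z_past|exact: mart_past].
- have m2 : measurable_fun setT (fun z : XX * (borel H * borel H) => z.2.1).
    exact: (measurableT_comp measurable_fst measurable_snd).
  have m3 : measurable_fun setT (fun z : XX * (borel H * borel H) => z.2.2).
    exact: (measurableT_comp measurable_snd measurable_snd).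
  have m1 : measurable_fun setT (fun z : XX * (borel H * borel H) => (z.1, z.2.1)).
    by apply: measurable_fun_pair.
  apply: measurable_funX; apply: borel_measurable_norm.
  apply: borel_measurable_sub => //; apply: borel_measurable_sub => //.
    exact: (measurableT_comp grad_g_meas m1).
  exact: (measurableT_comp grad_G_meas m2).
- by move=> z; exact: exprn_ge0.
- by move=> [h u]; exact: HD.
have -> : (fun w => phi (Xs n.+2 w, W w)) = fun w => `|mart n.+1 w| ^+ (2 * p.+1).
  by apply/funext => w; rewrite martS.
move=> i E; split => //; apply: (le_trans E).
have -> : Ex P (psi \o W) = (1 + (2 * N)^-1) * Ex P (fun w => `|mart n w| ^+ (2 * p.+1))
    + D * N ^+ p * (1 + Ex P (fun w => dist n.+1 w ^+ (2 * p.+1))).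
  rewrite [LHS](ExD j1 j3) (ExZ _ IHi) (ExZ _ j2).
  by rewrite (ExD (integrableR_cst P 1) ir) Ex_cst.
have nN : n%:R <= N by rewrite /N ler_nat.
have n0 : 0 <= n%:R :> R by [].
have N2 : 0 <= (2 * N)^-1 by rewrite invr_ge0 mulr_ge0// ltW.
have np : n%:R ^+ p <= N ^+ p by rewrite lerXn2r ?nnegrE// ltW.
have h1 : (1 + (2 * N)^-1) * Ex P (fun w => `|mart n w| ^+ (2 * p.+1)) <=
   (1 + (2 * N)^-1) * (2 * B * n%:R ^+ p.+1) by rewrite ler_wpM2l// addr_ge0.
have h2 : D * N ^+ p * (1 + Ex P (fun w => dist n.+1 w ^+ (2 * p.+1))) <= B * N ^+ p.
  by rewrite /B mulrAC ler_wpM2r ?(ltW Np0)// ler_wpM2l ?(ltW D0)// lerD2l.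
have h3 : n%:R ^+ p.+1 + N ^+ p <= N ^+ p.+1.
  rewrite !exprS [X in _ <= X * _](_ : N = n%:R + 1); last by rewrite natr1.
  by rewrite mulrDl mul1r lerD2r ler_wpM2l.
have h4 : (2 * N)^-1 * (2 * B * n%:R ^+ p.+1) <= B * N ^+ p.
  have -> : (2 * N)^-1 * (2 * B * n%:R ^+ p.+1) = B * (n%:R / N * n%:R ^+ p).
    by rewrite exprS; field; rewrite gt_eqF.
  rewrite ler_wpM2l ?(ltW B0)// (le_trans _ np)// ler_piMl ?exprn_ge0//.
  by rewrite ler_pdivrMr// mul1r.
have h5 : (1 + (2 * N)^-1) * (2 * B * n%:R ^+ p.+1) <=
    2 * B * n%:R ^+ p.+1 + B * N ^+ p by rewrite mulrDl mul1r lerD2l.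
apply: (le_trans (lerD (le_trans h1 h5) h2)).
have := ler_wpM2l (ltW B0) h3; rewrite -/N mulrDr; lra.
Qed.

(** * The averaged iterate *)

Context (T : {linear H -> H}) (lam Crem : R) (lam_gt0 : 0 < lam) (Crem_gt0 : 0 < Crem)
  (T_below : forall v, lam * `|v| <= `|T v|)
  (T_remainder : forall h, `|grad_G h - T (h - m)| <= Crem * `|h - m| ^+ 2).

(** The lower bound on T is applied once, to the sum of the errors, so that the increments xi_k add
    up inside the norm and their cancellation is preserved. *)
Lemma average_pointwise_le n w :
  lam * (n.+1%:R * `|n.+1%:R^-1 *: (\sum_(1 <= k < n.+2) Z k w) - m|) <=
  (gamma n.+1)^-1 * dist n.+2 w
  + \sum_(1 <= k < n.+2)
      (cg^-1 * k%:R `^ (alpha - 1) * dist k w + Crem * dist k w ^+ 2)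
  + `|mart n.+1 w|.
Proof.
have n0 : 0 < n.+1%:R :> R by rewrite ltr0n.
set S := \sum_(1 <= k < n.+2) (Z k w - m).
have -> : n.+1%:R^-1 *: (\sum_(1 <= k < n.+2) Z k w) - m = n.+1%:R^-1 *: S.
  have Em : \sum_(1 <= k < n.+2) m = n.+1%:R *: m.
    by rewrite sumr_const_nat subn1 scaler_nat.
  by rewrite /S sumrB Em scalerBr scalerA mulVf ?gt_eqF// scale1r.
rewrite normrZ gtr0_norm ?invr_gt0// mulrA mulfV ?gt_eqF// mul1r.
apply: (le_trans (T_below S)); rewrite /S linear_sum.
pose gi k := (gamma k)^-1.
have E k : (1 <= k)%N -> T (Z k w - m) = gi k *: ((Z k w - m) - (Z k.+1 w - m))
    + (grad_G (Z k w) - grad_g (Xs k.+1 w) (Z k w)) - (grad_G (Z k w) - T (Z k w - m)).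
  move=> k1; have g0 := gamma_gt0 k1; rewrite Z_rec//.
  have -> : Z k w - m - (Z k w - gamma k *: grad_g (Xs k.+1 w) (Z k w) - m) =
      gamma k *: grad_g (Xs k.+1 w) (Z k w).
    by rewrite opprB addrA subrK opprB addrC subrK.
  rewrite scalerA mulVf ?gt_eqF// scale1r.
  move: (T (Z k w - m)) (grad_G (Z k w)) (grad_g (Xs k.+1 w) (Z k w)) => t u v.
  by rewrite (addrC v) subrK opprB addrC subrK.
rewrite big_seq (eq_bigr _ (fun k ks => E k _)); last first.
  by move=> k; rewrite mem_index_iota => /andP[].
rewrite -big_seq sumrB big_split /=.
apply: (le_trans (ler_normB _ _)).
rewrite [X in _ <= _ + X + _]big_split /= addrA [leRHS]addrAC.
apply: lerD; last first.
  apply: (le_trans (ler_norm_sum _ _ _)).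
  rewrite big_seq [leRHS]big_seq; apply: ler_sum => k ks; exact: T_remainder.
apply: (le_trans (ler_normD _ _)); apply: lerD; last exact: lexx.
apply: (summation_by_parts_le (fun k => Z k w - m) n cg_gt0 (gi := gi)).
- by have := alpha_gt; lra.
- exact: ltW.
- by move=> k k1; rewrite /gi gamma_def.
Qed.

Lemma average_rate p : (0 < p)%N -> exists2 K, 0 < K & forall n, (1 <= n)%N ->
  (\int[P]_w (`|n%:R^-1 *: (\sum_(1 <= k < n.+1) Z k w) - m| ^+ (2 * p))%:E <=
    (K / n%:R ^+ p)%:E)%E.
Proof.
move=> p0; have [Ka Ka0 HKa] := sgd_rate p.
have ci0 : 0 < cg^-1 by rewrite invr_gt0.
have [Kb Kb0 HKb] : exists2 K, 0 < K & forall n, exists F : Omega -> R,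
    [/\ integrableR P F,
        forall w, (\sum_(1 <= k < n.+1)
          (cg^-1 * k%:R `^ (alpha - 1) * dist k w + Crem * dist k w ^+ 2)) ^+ (2 * p) <= F w
      & Ex P F <= K * n%:R ^+ p].
  apply: weighted_sum_moment => //; [exact: ltW|exact: ltW|exact: dist_ge0|].
  move=> q; have [K K0 HK] := sgd_rate q; exists K => // k k1; split; last exact: HK.
  exact: dist_moment_integrable.
have [Kc Kc0 HKc] : exists2 K, 0 < K & forall n,
    integrableR P (fun w => `|mart n w| ^+ (2 * p)) /\
    Ex P (fun w => `|mart n w| ^+ (2 * p)) <= K * n%:R ^+ p.
  by case: p p0 {HKa HKb} => // p _; exact: mart_moment.
set s := (2 * p)%N in HKa HKb HKc *.
have two0 : 0 < 2 ^+ s :> R by rewrite exprn_gt0.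
have cs0 : 0 < cg ^- s by rewrite invr_gt0 exprn_gt0.
have ls0 : 0 < lam ^- s by rewrite invr_gt0 exprn_gt0.
pose K0 := 2 ^+ s * (2 ^+ s * (cg ^- s * Ka + Kb) + Kc).
have K00 : 0 < K0 by rewrite mulr_gt0// addr_gt0// mulr_gt0// addr_gt0// mulr_gt0.
exists (lam ^- s * K0); first by rewrite mulr_gt0.
case=> // n _; set N : R := n.+1%:R.
have N0 : 0 < N by rewrite ltr0n.
have N1 : 1 <= N by rewrite ler1n.
have [F [iF FP EF]] := HKb n.+1; have [iM EM] := HKc n.+1.
have iD := dist_moment_integrable p (isT : (1 <= n.+2)%N).
have g0 := gamma_gt0 (isT : (1 <= n.+1)%N).
set gi := (gamma n.+1)^-1; have gi0 : 0 < gi by rewrite invr_gt0.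
have i1 := integrableRZ (gi ^+ s) iD.
have i2 := integrableRD i1 iF.
have i3 := integrableRZ (2 ^+ s) i2.
have i4 := integrableRD i3 iM.
have i5 := integrableRZ (2 ^+ s) i4.
have i6 := integrableRZ ((lam * N) ^- s) i5.
set Zb := fun w => N^-1 *: (\sum_(1 <= k < n.+2) Z k w) - m.
have le w : `|Zb w| ^+ s <= (lam * N) ^- s *
    (2 ^+ s * (2 ^+ s * (gi ^+ s * dist n.+2 w ^+ s + F w) + `|mart n.+1 w| ^+ s)).
  rewrite ler_pdivlMl ?exprn_gt0 ?mulr_gt0// -exprMn -mulrA.
  have := average_pointwise_le n w; rewrite -/N -/(Zb w) -/gi.
  set b := \sum_(1 <= k < _) _ => h.
  have b0 : 0 <= b.
    apply: sumr_ge0 => k _.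
    by rewrite addr_ge0 ?mulr_ge0 ?powR_ge0 ?dist_ge0 ?sqr_ge0// ltW.
  have a0 : 0 <= gi * dist n.+2 w by rewrite mulr_ge0 ?dist_ge0// ltW.
  apply: (@le_trans _ _ ((gi * dist n.+2 w + b + `|mart n.+1 w|) ^+ s)).
    rewrite lerXn2r ?nnegrE ?addr_ge0//.
    by rewrite mulr_ge0 ?(ltW lam_gt0)// mulr_ge0 ?(ltW N0).
  apply: (le_trans (powD_le _ (addr_ge0 a0 b0) (normr_ge0 _))).
  rewrite ler_wpM2l ?(ltW two0)// lerD2r.
  apply: (le_trans (powD_le _ a0 b0)).
  by rewrite ler_wpM2l ?(ltW two0)// exprMn lerD2l; exact: FP.
have iZ : integrableR P (fun w => `|Zb w| ^+ s).
  apply: integrableR_le i6 => [|w]; last by rewrite ger0_norm ?exprn_ge0.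
  apply: measurable_funX; apply: borel_measurable_norm; apply: borel_measurable_sub => //.
  apply: borel_measurable_scale; apply: borel_measurable_sum => // k.
  by rewrite mem_index_iota => /andP[k1 _]; exact: Z_measurable.
rewrite Ex_EFin// lee_fin (le_trans (Ex_le iZ i6 le))//.
rewrite (ExZ _ i5) (ExZ _ i4) (ExD i3 iM) (ExZ _ i2) (ExD i1 iF) (ExZ _ iD).
have Np0 : 0 < N ^+ p by rewrite exprn_gt0.
(* The boundary term has order N^(2 alpha p) N^(-alpha p) = N^(alpha p), below N^p because alpha <
   1. *)
have ED : gi ^+ s * Ex P (fun w => dist n.+2 w ^+ s) <= cg ^- s * Ka * N ^+ p.
  apply: (le_trans (ler_wpM2l (exprn_ge0 _ (ltW gi0)) (HKa n.+2 isT))).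
  have [e eE] : exists e, e = 2 * alpha * p%:R by exists (2 * alpha * p%:R).
  have -> : gi ^+ s = cg ^- s * N `^ e.
    rewrite /gi gamma_def// exprVn exprMn invfM powRN exprVn invrK powRXn ?(ltW N0)//.
    by rewrite eE /s natrM mulrA [alpha * 2]mulrC.
  rewrite -!mulrA ler_wpM2l ?(ltW cs0)// mulrCA ler_wpM2l ?(ltW Ka0)//.
  have al0 : 0 <= alpha by have := alpha_gt; lra.
  have alp0 : 0 <= alpha * p%:R by rewrite mulr_ge0.
  apply: (@le_trans _ _ (N `^ e * N `^ (- (alpha * p%:R)))).
    rewrite ler_wpM2l ?powR_ge0// !powRN lef_pV2 ?posrE ?powR_gt0//.
    by rewrite ge0_ler_powR ?nnegrE ?(ltW N0)// /N ler_nat.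
  rewrite -powRDp// -(powR_mulrn p (ltW N0)) ler_powR//.
  have : 0 <= (1 - alpha) * p%:R by rewrite mulr_ge0// subr_ge0 ltW.
  by rewrite eE; lra.
have k1 := ler_wpM2l (ltW two0) (lerD ED EF).
have k2 := ler_wpM2l (ltW two0) (lerD k1 EM).
have Ls0 : 0 < (lam * N) ^- s by rewrite invr_gt0 exprn_gt0 ?mulr_gt0.
apply: (le_trans (ler_wpM2l (ltW Ls0) k2)).
rewrite le_eqVlt; apply/orP; left; apply/eqP.
have -> : (lam * N) ^- s = lam ^- s * (N ^- p * N ^- p).
  by rewrite exprMn invfM /s mul2n -addnn (exprD N) invfM.
have NN : N ^- p * N ^+ p = 1 by rewrite mulVf// gt_eqF.
transitivity (lam ^- s * K0 * N ^- p * (N ^- p * N ^+ p)); last by rewrite NN mulr1.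
rewrite /K0 -/N; move: (lam ^- s) (N ^- p) (cg ^- s) => x y z; ring.
Qed.

End stochastic_gradient.

(** * The main theorem *)

Section hypotheses.
Context {R : realType} {H : completeNormedModType R} (dot : {dot H for idfun}).
Context (dotE : hilbert_dot dot) (Hsep : separable H).

Lemma eigen_inf_gt0 (T : H -> H) : (0 < eigen_inf T)%E ->
  exists2 lam : R, 0 < lam & forall l, is_eigenvalue T l -> lam <= l.
Proof.
move=> T0; have le l : is_eigenvalue T l -> (eigen_inf T <= l%:E)%E.
  by move=> Tl; apply: ereal_inf_lbound; exists l.
move: T0 le; case: (eigen_inf T) => [r||] //= r0 le.
  by exists r; [rewrite -lte_fin|move=> l /le; rewrite lee_fin].
(* An infinite infimum means that there is no eigenvalue, and any positive constant works. *)
by exists 1 => // l /le; rewrite leye_eq.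
Qed.

Lemma continuous_linear_bound (T : {linear H -> H}) : continuous T ->
  exists2 B : R, 0 < B & forall v, `|T v| <= B * `|v|.
Proof.
move=> /linear_bounded_continuous/linear_boundedP[M [_ HM]].
exists (`|M| + 1) => [|v]; first by rewrite ltr_wpDl.
by apply: HM; rewrite (le_lt_trans (ler_norm M))// ltrDl.
Qed.

Lemma coercive_below (T : H -> H) (lam : R) :
  (forall v, lam * `|v| ^+ 2 <= dot (T v) v) -> forall v, lam * `|v| <= `|T v|.
Proof.
move=> lamT v; have [->|v0] := eqVneq v 0; first by rewrite normr0 mulr0.
have nv : 0 < `|v| by rewrite normr_gt0.
rewrite -(ler_pM2r nv) -mulrA -expr2; apply: (le_trans (lamT v)).
exact: le_trans (ler_norm _) (dot_cauchy_schwarz dotE _ _).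
Qed.

Context {d d' : measure_display} {Omega : measurableType d} {XX : measurableType d'}
  (P : probability Omega R) (X : {RV P >-> XX}).
Context (grad_g : XX -> H -> H) (grad_G : H -> H) (m : H).
Context (grad_g_meas : measurable_fun setT
  ((fun z => grad_g z.1 z.2) : XX * borel H -> borel H)).

(** The mean is known only through its dot products, so it is tested against v = [grad_G h] itself,
    which gives |v|^2 as the expectation of <Y, v>. *)
Lemma mean_linear_growth (L : R) :
  (forall h u, (\int[P]_w (dot (grad_g (X w) h) u)%:E = (dot (grad_G h) u)%:E)%E) ->
  0 < L ->
  (forall h, (\int[P]_w (`|grad_g (X w) h| ^+ 2)%:E <= (L * (1 + `|h - m| ^+ 2))%:E)%E) ->
  forall h, `|grad_G h| <= (1 + L) * (1 + `|h - m|).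
Proof.
move=> mean L0 HL h; set r := `|h - m|; set v := grad_G h.
have r0 : 0 <= r by exact: normr_ge0.
have mY := grad_g_obs_measurable X grad_g_meas h.
have [i E] : integrableR P (fun w => `|grad_g (X w) h| ^+ 2) /\
    Ex P (fun w => `|grad_g (X w) h| ^+ 2) <= L * (1 + r ^+ 2).
  apply: integrableR_of_le; [|by []|exact: HL].
  by apply: measurable_funX; exact: borel_measurable_norm.
have [v0|vN0] := eqVneq v 0; first by rewrite v0 normr0 mulr_ge0 ?addr_ge0// ltW.
have nv : 0 < `|v| by rewrite normr_gt0.
(* Writing |Y| <= (s^2 + |Y|^2)/s at the scale s = 1 + r turns the quadratic moment bound into
   linear growth. *)
pose s := 1 + r; have s0 : 0 < s by rewrite /s; lra.
have j := integrableRZ (`|v| / s) (integrableRD (integrableR_cst P (s ^+ 2)) i).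
have le w : `|dot (grad_g (X w) h) v| <= `|v| / s * (s ^+ 2 + `|grad_g (X w) h| ^+ 2).
  apply: (le_trans (dot_cauchy_schwarz dotE _ _)); rewrite mulrC -mulrA.
  rewrite ler_wpM2l// mulrC ler_pdivlMr//; set y := `|grad_g _ _|.
  have y0 : 0 <= y by exact: normr_ge0.
  by have := sqr_ge0 (y - s); rewrite sqrrB; have := mulr_ge0 y0 (ltW s0); lra.
have id : integrableR P (fun w => dot (grad_g (X w) h) v).
  by apply: integrableR_le le j; apply: borel_measurable_dot => //; exact: measurable_cst.
have := Ex_le id j (fun w => le_trans (ler_norm _) (le w)).
have -> : Ex P (fun w => dot (grad_g (X w) h) v) = `|v| ^+ 2.
  by rewrite -dotE; apply: EFin_inj; rewrite -Ex_EFin.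
rewrite (ExZ _ (integrableRD (integrableR_cst P (s ^+ 2)) i)).
rewrite (ExD (integrableR_cst P (s ^+ 2)) i) Ex_cst expr2 -mulrA ler_pM2l// => h1.
apply: (le_trans h1); rewrite ler_pdivrMl//.
have : L * (1 + r ^+ 2) <= L * s ^+ 2.
  by rewrite ler_wpM2l ?(ltW L0)// /s sqrrD expr1n; lra.
rewrite -/s; lra.
Qed.

(** Reduces the first form of (v) to the second. The integral is moved to the law of X, where the
    almost-everywhere domination is stated. *)
Lemma moments_of_domination (f : XX -> H -> R) (C : R) :
  measurable_fun setT ((fun z => f z.1 z.2) : XX * borel H -> R) ->
  (forall x h, 0 <= f x h) -> 0 < C ->
  {ae distribution P X, forall x, forall h, `|grad_g x h| <= f x h + C * `|h - m|} ->
  (forall q : nat, (1 <= q)%N -> exists2 L : R, 0 < L &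
     forall h, (\int[P]_w (f (X w) h ^+ (2 * q))%:E <= L%:E)%E) ->
  forall q : nat, (1 <= q)%N -> exists2 L : R, 0 < L & forall h,
    (\int[P]_w (`|grad_g (X w) h| ^+ (2 * q))%:E <= (L * (1 + `|h - m| ^+ (2 * q)))%:E)%E.
Proof.
move=> mf f0 C0 dom fmom q q1; have [L L0 HL] := fmom q q1.
set s := (2 * q)%N in HL *.
have two0 : 0 < 2 ^+ s :> R by rewrite exprn_gt0.
have Cs0 : 0 < C ^+ s by rewrite exprn_gt0.
exists (2 ^+ s * (L + C ^+ s)); first by rewrite mulr_gt0// addr_gt0.
move=> h; set r := `|h - m|; have r0 : 0 <= r by exact: normr_ge0.
have mfh : measurable_fun setT (fun x => f x h).
  exact: (measurable_fun_pair1 (h : borel H) mf).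
have mgh : measurable_fun setT (fun x => grad_g x h : borel H).
  exact: (measurable_fun_pair1 (h : borel H) grad_g_meas).
have [i E] : integrableR P (fun w => f (X w) h ^+ s) /\ Ex P (fun w => f (X w) h ^+ s) <= L.
  apply: integrableR_of_le => //; last by move=> w; rewrite exprn_ge0.
  by apply: measurable_funX; exact: (measurableT_comp mfh).
pose b x := 2 ^+ s * (f x h ^+ s + (C * r) ^+ s).
have b0 x : 0 <= b x by rewrite /b mulr_ge0 ?(ltW two0)// addr_ge0 ?exprn_ge0 ?mulr_ge0 ?(ltW C0).
have mb : measurable_fun setT b.
  apply: measurable_funM => //; apply: measurable_funD => //.
  exact: measurable_funX.
have -> : (\int[P]_w (`|grad_g (X w) h| ^+ s)%:E =
    \int[distribution P X]_x (`|grad_g x h| ^+ s)%:E)%E.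
  rewrite ge0_integral_distribution//.
  by apply/measurable_EFinP; apply: measurable_funX; exact: borel_measurable_norm.
apply: (@le_trans _ _ (\int[distribution P X]_x (b x)%:E)%E).
  apply: ae_ge0_le_integral => //.
  - by apply/measurable_EFinP; apply: measurable_funX; exact: borel_measurable_norm.
  - by move=> x _; rewrite lee_fin.
  - exact/measurable_EFinP.
  - apply: filterS dom => x domx _; rewrite lee_fin.
    apply: (@le_trans _ _ ((f x h + C * r) ^+ s)).
      by rewrite lerXn2r ?nnegrE// ?addr_ge0 ?mulr_ge0 ?(ltW C0)//; exact: domx.
    by apply: powD_le => //; rewrite mulr_ge0 ?(ltW C0).
rewrite ge0_integral_distribution//; last exact/measurable_EFinP.
have j := integrableRD i (integrableR_cst P ((C * r) ^+ s)).
rewrite [X in (X <= _)%E](Ex_EFin (integrableRZ (2 ^+ s) j)) lee_fin (ExZ _ j).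
rewrite (ExD i (integrableR_cst P _)) Ex_cst -mulrA ler_wpM2l ?(ltW two0)//.
rewrite exprMn mulrDl !mulrDr !mulr1.
have h1 : 0 <= L * r ^+ s by rewrite mulr_ge0 ?exprn_ge0// ltW.
have h2 : 0 <= C ^+ s by exact: ltW.
lra.
Qed.

End hypotheses.

Theorem theorem4p4 (R : realType)
  (* separable real Hilbert space *)
  (H : completeNormedModType R) (dot : {dot H for idfun})
  (H_hilbert : hilbert_dot dot) (H_separable : separable H)
  (* random variables *)
  (d d' : measure_display) (Omega : measurableType d) (XX : measurableType d')
  (P : probability Omega R) (X : {RV P >-> XX}) (Xs : nat -> {RV P >-> XX})
  (Xs_indep : mutually_independent P [set n | (1 <= n)%N]
                (fun n => Xs n : Omega -> XX))
  (Xs_law : forall n, (1 <= n)%N -> same_law (Xs n) X)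
  (* the objective G, its gradient and its Hessian *)
  (g : XX -> H -> R) (grad_g : XX -> H -> H)
  (G : H -> R) (grad_G : H -> H) (Gam : H -> H -> H) (m : H)
  (g_integrable : forall h, P.-integrable setT (EFin \o (fun w => g (X w) h)))
  (G_def : forall h, 'E_P[fun w => g (X w) h]%E = (G h)%:E)
  (G_convex : convex_function [set: convex_lmodType H] G)
  (grad_g_meas : measurable_fun setT
     ((fun z => grad_g z.1 z.2) : XX * borel H -> borel H))
  (grad_G_mean : forall h, is_mean dot P (fun w => grad_g (X w) h) (grad_G h))
  (* the algorithm *)
  (c_gamma alpha : R) (c_gamma_gt0 : 0 < c_gamma)
  (alpha_bounds : 2^-1 < alpha < 1)
  (gamma : nat -> R)
  (gamma_def : forall n, (1 <= n)%N -> gamma n = c_gamma * n%:R `^ (- alpha))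
  (Z Zbar : nat -> Omega -> H)
  (Z1_meas : preimage_set_system setT (Z 1%N : Omega -> borel H) measurable
               `<=` natural_filtration (fun n => Xs n : Omega -> XX) 1)
  (Z1_bounded : exists M : R, {ae P, forall w, `|Z 1%N w| <= M})
  (Z_rec : forall n w, (1 <= n)%N ->
     Z n.+1 w = Z n w - gamma n *: grad_g (Xs n.+1 w) (Z n w))
  (Zbar_def : forall n w, (1 <= n)%N ->
     Zbar n w = n%:R^-1 *: \sum_(1 <= k < n.+1) Z k w)
  (* (i) *)
  (hyp_i_g : forall h,
     {ae distribution P X, forall x, is_gradient dot (g x) h (grad_g x h)})
  (hyp_i_G : forall h, is_gradient dot G h (grad_G h))
  (hyp_i_m : grad_G m = 0)
  (* (ii) *)
  (hyp_ii_C2 : continuous_hessian grad_G Gam)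
  (hyp_ii_bound : forall A : R, 0 < A -> exists2 C : R, 0 < C &
     forall h, `|h - m| <= A -> opnorm (Gam h) <= C)
  (* (iii) *)
  (hyp_iii :
     (exists2 eps : R, 0 < eps &
        [/\ forall h, `|h - m| <= eps -> has_eigenbasis dot (Gam h),
            (0 < eigen_inf (Gam m))%E
          & forall h, `|h - m| <= eps -> forall l, is_eigenvalue (Gam h) l ->
              (eigen_inf (Gam m) * (2^-1)%:E <= l%:E)%E])
     \/
     [/\ has_eigenbasis dot (Gam m),
         (0 < eigen_inf (Gam m))%E
       & exists c c' : R, [/\ 0 < c, 0 < c' & forall A : R, 0 < A ->
           forall h, `|h - m| <= A ->
           Num.min c (c' / A) * `|h - m| ^+ 2 <= dot (grad_G h) (h - m)]])
  (* (iv) *)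
  (hyp_iv : exists eps' C : R, [/\ 0 < eps', 0 < C &
     forall h, `|h - m| <= eps' ->
       `|grad_G h - Gam m (h - m)| <= C * `|h - m| ^+ 2])
  (* (v) *)
  (hyp_v :
     (exists (f : XX -> H -> R) (C : R),
        [/\ measurable_fun setT ((fun z => f z.1 z.2) : XX * borel H -> R),
            forall x h, 0 <= f x h,
            0 < C,
            {ae distribution P X, forall x,
               forall h, `|grad_g x h| <= f x h + C * `|h - m|}
          & forall q : nat, (1 <= q)%N -> exists2 L : R, 0 < L &
              forall h, ('E_P[fun w => (f (X w) h ^+ (2 * q))%R] <= L%:E)%E])
     \/
     (forall q : nat, (1 <= q)%N -> exists2 L : R, 0 < L &
        forall h, ('E_P[fun w => (`|grad_g (X w) h| ^+ (2 * q))%R]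
                    <= (L * (1 + `|h - m| ^+ (2 * q)))%:E)%E)) :
  forall p : nat, (1 <= p)%N -> exists2 K : R, 0 < K &
    forall n : nat, (1 <= n)%N ->
      ('E_P[fun w => (`|Zbar n w - m| ^+ (2 * p))%R] <= (K / n%:R ^+ p)%:E)%E.
Proof.
have [hess_diff _] := hyp_ii_C2.
have [dG dGE] := hess_diff m.
(* The differential coincides with [Gam m] and carries the linear structure that the bare function
   lacks. *)
pose T : {linear H -> H} := 'd grad_G m.
have TE v : T v = Gam m v by rewrite /T dGE.
have cT : continuous T by exact: diff_continuous.
(* Both alternatives of (iii) give a spectral gap at [m]; in the first one, the eigenbasis is taken
   at h = m. *)
have Gam_eigen : has_eigenbasis dot (Gam m) /\ (0 < eigen_inf (Gam m))%E.
  case: hyp_iii => [[eps eps0 [basis inf _]]|[basis inf _]]; last by [].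
  by split => //; apply: basis; rewrite subrr normr0 ltW.
have TGam : (T : H -> H) = Gam m by apply/funext => v; exact: TE.
have [lam lam0 lamP] := eigen_inf_gt0 Gam_eigen.2.
have coer v : lam * `|v| ^+ 2 <= dot (T v) v.
  by apply: eigenbasis_coercive => //; rewrite TGam//; exact: Gam_eigen.1.
have [eps [C [eps0 C0 near]]] := hyp_iv.
have nearT h : `|h - m| <= eps -> `|grad_G h - T (h - m)| <= C * `|h - m| ^+ 2.
  by rewrite TE; exact: near.
have mean h u : (\int[P]_w (dot (grad_g (X w) h) u)%:E = (dot (grad_G h) u)%:E)%E.
  by have [_ _ /(_ u)] := grad_G_mean h; rewrite expectationE.
have moments q : exists2 L : R, 0 < L & forall h,
    (\int[P]_w (`|grad_g (X w) h| ^+ (2 * q.+1))%:E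
      <= (L * (1 + `|h - m| ^+ (2 * q.+1)))%:E)%E.
  case: hyp_v => [[f [Cf [mf f0 Cf0 dom fmom]]]|vb].
    apply: (moments_of_domination grad_g_meas mf f0 Cf0 dom _ (isT : (1 <= q.+1)%N)).
    move=> k k1; have [L L0 HL] := fmom k k1; exists L => // h.
    by have := HL h; rewrite expectationE.
  have [L L0 HL] := vb q.+1 isT; exists L => // h.
  by have := HL h; rewrite expectationE.
have [L L0 HL] := moments 0.
have lin := mean_linear_growth H_hilbert H_separable grad_g_meas mean L0 HL.
have Lin0 : 0 < 1 + L by lra.
have [B B0 TB] := continuous_linear_bound cT.
have [Cr Cr0 rem] := linear_remainder_quadratic TB B0 Lin0 lin eps0 C0 nearT.
have [c c0 drift] := gradient_lower_bound H_hilbert G_convex hyp_i_G hyp_i_m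
  lam0 coer eps0 C0 nearT.
have grad_G_meas : measurable_fun setT (grad_G : borel H -> borel H).
  apply: continuous_borel_measurable => h; have [dh _] := hess_diff h.
  exact: differentiable_continuous.
have Z1_past : measurable_fun setT (Z 1%N : past Xs 1 -> borel H).
  by move=> _ A mA; apply: Z1_meas; exists A.
have /andP[al2 al1] := alpha_bounds.
move=> p p1.
have [K K0 HK] := average_rate H_hilbert H_separable Xs_indep Xs_law grad_g_meas
  grad_G_meas mean moments c0 drift c_gamma_gt0 al2 al1 gamma_def Z1_past Z1_bounded
  Z_rec Lin0 lin lam0 Cr0 (coercive_below H_hilbert coer) rem p1.
exists K => // n n1; rewrite expectationE.
have -> : (fun w => (`|Zbar n w - m| ^+ (2 * p))%:E) =
    fun w => (`|n%:R^-1 *: (\sum_(1 <= k < n.+1) Z k w) - m| ^+ (2 * p))%:E.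
  by apply/funext => w; rewrite Zbar_def.
exact: HK.
Qed.
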